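(* Let $(X,g)$ and $(Y,h)$ be two spacetimes and let $F\colon\Pi^{\mathrm c}(X)\to\Pi^{\mathrm c}(Y)$ be an isomorphism of categories, or $F\colon\Pi^{\mathrm t}(X)\to\Pi^{\mathrm t}(Y)$ an isomorphism of semicategories. If the object map $X\to Y$ of $F$ is a diffeomorphism, then it is a conformal diffeomorphism.
   Context: A spacetime is a smooth manifold $X$ with a smooth Lorentzian metric $g$ and a time orientation; no causality condition is assumed. For an open set $U\subseteq X$ and $x,y\in U$, write $x\ll_U y$ if there is a future-directed timelike piecewise $\mathcal C^1$ curve in $U$ from $x$ to $y$, and $x\le_U y$ if $x=y$ or there is a future-directed causal piecewise $\mathcal C^1$ curve in $U$ from $x$ to $y$. A path is a continuous map $c\colon[0,1]\to X$. It is (continuous, future-directed) timelike if for every $t_0\in[0,1]$ and every open neighborhood $U$ of $c(t_0)$ there is $\delta>0$ such that $c(s)\ll_U c(t)$ for all $s<t$ in $(t_0-\delta,t_0+\delta)\cap[0,1]$; it is (continuous, future-directed) causal if the same holds with $\le_U$ in place of $\ll_U$ (so constant paths are causal). $P^{\mathrm t}(X)\subseteq P^{\mathrm c}(X)$ denote the sets of timelike, respectively causal, paths, and $P^{\mathrm t}(X)(x,y)$, $P^{\mathrm c}(X)(x,y)$ the subsets of those from $x$ to $y$. Two paths $c_0,c_1\in P^{\mathrm t}(X)(x,y)$ are timelike homotopic, $c_0\sim_{\mathrm t}c_1$, if there is a continuous map $H\colon[0,1]^2\to X$, $(s,t)\mapsto c_s(t)$, joining $c_0$ to $c_1$ with $c_s\in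 P^{\mathrm t}(X)(x,y)$ for all $s\in[0,1]$; causal homotopy $\sim_{\mathrm c}$ is defined in the same way with $P^{\mathrm c}$ in place of $P^{\mathrm t}$. The concatenation $ba$ is ''first $a$, then $b$'', reparametrized linearly to $[0,1]$. A semicategory is like a category but without the requirement that identity morphisms exist; a functor of semicategories is a map on objects and morphisms compatible with source, target and composition; an isomorphism is a functor with an inverse functor. $\Pi^{\mathrm t}(X)$ is the semicategory, and $\Pi^{\mathrm c}(X)$ the category, with object set $X$, morphism sets $P^{\mathrm t}(X)(x,y)/{\sim_{\mathrm t}}$, respectively $P^{\mathrm c}(X)(x,y)/{\sim_{\mathrm c}}$, and composition $[b][a]=[ba]$. A diffeomorphism $f\colon X\to Y$ is conformal if $f^*h=\Omega g$ for some positive smooth function $\Omega$ on $X$. *)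

(* Defs.v *)
From HB Require Import structures.
From mathcomp Require Import all_boot all_order all_algebra generic_quotient.
From mathcomp Require Import all_classical all_reals.
From mathcomp Require Import topology normedtype derive.
From mathcomp Require Import ring lra.
Set Implicit Arguments.
Unset Strict Implicit.
Unset Printing Implicit Defensive.
Import Order.TTheory GRing.Theory Num.Theory.
Import numFieldNormedType.Exports.
Local Open Scope classical_set_scope.
Local Open Scope ring_scope.
Local Open Scope quotient_scope.

Record semicategory : Type := Semicategory {
  object :> Type;
  hom : object -> object -> Type;
  comp : forall x y z : object, hom y z -> hom x y -> hom x z;
  compA : forall (w x y z : object)
    (h : hom y z) (g : hom x y) (f : hom w x),
    comp h (comp g f) = comp (comp h g) f }.

Record category : Type := Category {
  category_semi :> semicategory;
  idm : forall x : category_semi, hom x x;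
  comp1m : forall (x y : category_semi) (f : hom x y), comp (idm y) f = f;
  compm1 : forall (x y : category_semi) (f : hom x y), comp f (idm x) = f }.

Record semifunctor (C D : semicategory) : Type := Semifunctor {
  fobj :> C -> D;
  fhom : forall x y : C, hom x y -> hom (fobj x) (fobj y);
  fhomM : forall (x y z : C) (g : hom y z) (f : hom x y),
    fhom (comp g f) = comp (fhom g) (fhom f) }.

Record functor (C D : category) : Type := Functor {
  functor_semi :> semifunctor C D;
  fhom1 : forall x : C, fhom functor_semi (idm x) = idm (functor_semi x) }.

Definition semifunctor_id (C : semicategory) : semifunctor C C :=
  @Semifunctor C C id (fun _ _ => id) (fun _ _ _ _ _ => erefl).

Program Definition semifunctor_comp (C D E : semicategory)
    (G : semifunctor D E) (F : semifunctor C D) : semifunctor C E :=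
  @Semifunctor C E (G \o F) (fun _ _ f => fhom G (fhom F f)) _.
Next Obligation. by move=> * /=; rewrite !fhomM. Qed.

Definition functor_id (C : category) : functor C C :=
  @Functor C C (semifunctor_id C) (fun=> erefl).

Program Definition functor_comp (C D E : category)
    (G : functor D E) (F : functor C D) : functor C E :=
  @Functor C E (semifunctor_comp G F) _.
Next Obligation. by move=> * /=; rewrite !fhom1. Qed.

Definition semicategory_iso (C D : semicategory) (F : semifunctor C D) : Prop :=
  exists G : semifunctor D C,
    semifunctor_comp G F = semifunctor_id C /\
    semifunctor_comp F G = semifunctor_id D.

Definition category_iso (C D : category) (F : functor C D) : Prop :=
  exists G : functor D C,
    functor_comp G F = functor_id C /\ functor_comp F G = functor_id D.

Section continuity_on_subsets.
Context {R : realType}.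

Lemma within_comp (T U V : topologicalType) (A : set T) (B : set U)
    (g : T -> U) (f : U -> V) :
  continuous g -> (forall x, A x -> B (g x)) ->
  {within B, continuous f} -> {within A, continuous (f \o g)}.
Proof.
move=> cg AB /subspace_continuousP cf; apply/subspace_continuousP => x Ax.
move=> W /(cf (g x) (AB x Ax)) fW.
have : nbhs (g x) (fun y => B y -> W (f y)) by [].
move=> /(cg x); rewrite /nbhs /= /within /=.
by apply: filterS => z /= gz Az; apply: gz; apply: AB.
Qed.

Lemma continuous_pair (T U V : topologicalType) (f : T -> U) (g : T -> V) :
  continuous f -> continuous g -> continuous (fun x => (f x, g x)).
Proof. by move=> cf cg x; exact: (cvg_pair (cf x) (cg x)). Qed.

Lemma within_paste (T V : topologicalType) (A : set T) (h : T -> R) (r : R)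
    (f1 f2 : T -> V) :
  closed A -> continuous h ->
  {within A `&` [set x | h x <= r], continuous f1} ->
  {within A `&` [set x | r <= h x], continuous f2} ->
  (forall x, A x -> h x = r -> f1 x = f2 x) ->
  {within A, continuous (fun x => if h x <= r then f1 x else f2 x)}.
Proof.
move=> cA ch c1 c2 f12.
have -> : A = (A `&` [set x | h x <= r]) `|` (A `&` [set x | r <= h x]).
  apply/seteqP; split=> x /=; last by case=> -[].
  by move=> Ax; have [?|/ltW ?] := leP (h x) r; [left|right].
apply: withinU_continuous.
- by apply: closedI => //; exact: (proj1 (continuous_closedP h) ch _ (@closed_le R r)).
- by apply: closedI => //; exact: (proj1 (continuous_closedP h) ch _ (@closed_ge R r)).
- apply: subspace_eq_continuous c1 => x /set_mem /= [_ hx].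
  by rewrite /from_subspace hx.
- apply: subspace_eq_continuous c2 => x /set_mem /= [Ax hx].
  by rewrite /from_subspace; case: ifPn => // hx'; rewrite f12//; apply/eqP; rewrite eq_le hx hx'.
Qed.

Lemma closed_square : closed (`[0, 1]%classic `*` `[0, 1]%classic : set (R * R)).
Proof.
have -> : `[0, 1]%classic `*` `[0, 1]%classic =
   (@fst R R @^-1` `[0, 1]%classic) `&` (@snd R R @^-1` `[0, 1]%classic).
  by [].
apply: closedI; apply: (proj1 (continuous_closedP _)); try exact: itv_closed.
  by move=> x; exact: cvg_fst.
by move=> x; exact: cvg_snd.
Qed.

End continuity_on_subsets.

(* A transitive relation on X for every subset U, to be thought of as
   `y can be reached from x inside U'. *)
Record local_order (X : topologicalType) : Type := LocalOrder {
  lrel :> set X -> X -> X -> Prop;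
  lrel_trans : forall (U : set X) (x y z : X),
    lrel U x y -> lrel U y z -> lrel U x z }.

Definition reflexive_order (X : topologicalType) (L : local_order X) : Prop :=
  forall (U : set X) (x : X), U x -> L U x x.

Section paths.
Context {R : realType} {X : topologicalType}.
Implicit Types (L : local_order X) (x y z : X) (c a b : R -> X).

(* Maps out of [0, 1] (resp. [0, 1]^2) are represented by total functions on R
   (resp. R * R) whose values outside are ignored; two paths that agree on
   [0, 1] are homotopic, hence have the same class. *)
Definition locally_ordered L c : Prop :=
  forall t0 : R, t0 \in `[0, 1] ->
  forall U : set X, open U -> U (c t0) ->
  exists2 d : R, 0 < d &
    forall s t : R, s \in `]t0 - d, t0 + d[ -> s \in `[0, 1] ->
      t \in `]t0 - d, t0 + d[ -> t \in `[0, 1] -> s < t -> L U (c s) (c t).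

Definition is_path L x y c : Prop :=
  [/\ {within `[0, 1]%classic, continuous c}, locally_ordered L c,
      c 0 = x & c 1 = y].

Definition path_homotopy L x y c0 c1 : Prop :=
  exists H : R * R -> X,
    [/\ {within `[0, 1]%classic `*` `[0, 1]%classic, continuous H},
        {in `[0, 1], forall t, H (0, t) = c0 t},
        {in `[0, 1], forall t, H (1, t) = c1 t} &
        {in `[0, 1], forall s, is_path L x y (fun t => H (s, t))}].

(* First a, then b. *)
Definition concat a b : R -> X :=
  fun t => if t <= 2^-1 then a (2 * t) else b (2 * t - 1).

Lemma is_path_eq L x y c c' :
  {in `[0, 1], c =1 c'} -> is_path L x y c -> is_path L x y c'.
Proof.
move=> e [cc oc c0 c1]; split.
- apply: subspace_eq_continuous cc => t /set_mem /= tI.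
  by rewrite /from_subspace e.
- move=> t0 t0I U oU; rewrite -e // => Ut0.
  have [d d0 dP] := oc t0 t0I U oU Ut0.
  by exists d => // s t s1 s2 t1 t2 st; rewrite -!e//; exact: dP.
- by rewrite -e ?in_itv //= ?lexx ?ler01.
- by rewrite -e ?in_itv //= ?lexx ?ler01.
Qed.

Lemma concat_path L x y z a b :
  is_path L x y a -> is_path L y z b -> is_path L x z (concat a b).
Proof.
move=> [ca oa a0 a1] [cb ob b0 b1]; split.
- apply: (@within_paste R _ _ _ id).
  + exact: itv_closed.
  + by move=> ?; exact: cvg_id.
  + apply: (within_comp (g := fun t : R => 2 * t)) ca.
      by move=> t; apply: cvgM; [exact: cvg_cst|exact: cvg_id].
    by move=> t /=; rewrite !in_itv /= => -[/andP[? ?] ?]; apply/andP; split; lra.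
  + apply: (within_comp (g := fun t : R => 2 * t - 1)) cb.
      move=> t; apply: cvgB; last exact: cvg_cst.
      by apply: cvgM; [exact: cvg_cst|exact: cvg_id].
    by move=> t /=; rewrite !in_itv /= => -[/andP[? ?] ?]; apply/andP; split; lra.
  + move=> t _ ->; have -> : 2 * 2^-1 = 1 :> R by lra.
    by rewrite subrr a1 b0.
- move=> t0; rewrite in_itv /= => /andP[t00 t01] U oU.
  have [tlt|tgt|teq] := ltgtP t0 2^-1.
  + rewrite /concat (ltW tlt) => Ut0.
    have [|d d0 dP] := oa (2 * t0) _ U oU Ut0.
      by rewrite in_itv /=; apply/andP; split; lra.
    exists (Num.min (d / 2) (2^-1 - t0)).
      by rewrite lt_min; apply/andP; split; lra.
    set m := Num.min _ _.
    have m1 : m <= d / 2 by rewrite /m ge_min lexx.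
    have m2 : m <= 2^-1 - t0 by rewrite /m ge_min lexx orbT.
    move=> s t; rewrite !in_itv /= => /andP[s1 s2] /andP[s3 s4].
    move=> /andP[t1 t2] /andP[t3 t4] st.
    rewrite ifT; last by lra.
    rewrite ifT; last by lra.
    by apply: dP; rewrite ?in_itv /= ?ltr_pM2l//; try (apply/andP; split); lra.
  + rewrite /concat ifF; last by apply/negbTE; rewrite -ltNge.
    move=> Ut0.
    have [|d d0 dP] := ob (2 * t0 - 1) _ U oU Ut0.
      by rewrite in_itv /=; apply/andP; split; lra.
    exists (Num.min (d / 2) (t0 - 2^-1)).
      by rewrite lt_min; apply/andP; split; lra.
    set m := Num.min _ _.
    have m1 : m <= d / 2 by rewrite /m ge_min lexx.
    have m2 : m <= t0 - 2^-1 by rewrite /m ge_min lexx orbT.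
    move=> s t; rewrite !in_itv /= => /andP[s1 s2] /andP[s3 s4].
    move=> /andP[t1 t2] /andP[t3 t4] st.
    rewrite ifF; last by apply/negbTE; rewrite -ltNge; lra.
    rewrite ifF; last by apply/negbTE; rewrite -ltNge; lra.
    by apply: dP; rewrite ?in_itv /=; try (apply/andP; split); lra.
  + rewrite teq /concat lexx; have -> : 2 * 2^-1 = 1 :> R by lra.
    move=> Ua1.
    have [|d d0 dP] := oa 1 _ U oU Ua1; first by rewrite in_itv /= ler01 lexx.
    have [| |e e0 eP] := ob 0 _ U oU _; first by rewrite in_itv /= ler01 lexx.
      by rewrite b0 -a1.
    exists (Num.min (d / 2) (e / 2)).
      by rewrite lt_min; apply/andP; split; lra.
    set m := Num.min _ _.
    have m1 : m <= d / 2 by rewrite /m ge_min lexx.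
    have m2 : m <= e / 2 by rewrite /m ge_min lexx orbT.
    have aP (s t : R) : s \in `]2^-1 - m, 2^-1 + m[ -> s \in `[0, 1] ->
        s < t -> t <= 2^-1 -> L U (a (2 * s)) (a (2 * t)).
      rewrite !in_itv /= => /andP[s1 s2] /andP[s3 s4] st t2.
      by apply: dP; rewrite ?in_itv /=; try (apply/andP; split); lra.
    have bP (s t : R) : t \in `]2^-1 - m, 2^-1 + m[ -> t \in `[0, 1] ->
        s < t -> 2^-1 <= s -> L U (b (2 * s - 1)) (b (2 * t - 1)).
      rewrite !in_itv /= => /andP[s1 s2] /andP[s3 s4] st t2.
      by apply: eP; rewrite ?in_itv /=; try (apply/andP; split); lra.
    move=> s t sm sI tm tI st.
    have [sh|sh] := leP s 2^-1; have [th|th] := leP t 2^-1.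
    * exact: aP.
    * have bb : L U (b 0) (b (2 * t - 1)).
        by have := bP _ _ tm tI th (lexx _); rewrite (_ : 2 * 2^-1 - 1 = 0 :> R)//; lra.
      move: sh; rewrite le_eqVlt => /predU1P[->|sh].
        have -> : 2 * 2^-1 = 1 :> R by lra.
        by rewrite a1 -b0.
      apply: lrel_trans bb; rewrite b0 -a1.
      have := aP _ _ sm sI sh (lexx _).
      by rewrite (_ : 2 * 2^-1 = 1 :> R)//; lra.
    * by have := lt_le_trans (lt_trans sh st) th; rewrite ltxx.
    * by apply: bP => //; exact: ltW.
- by rewrite /concat mulr0 ifT// invr_ge0.
- rewrite /concat ifF; last by apply/negbTE; rewrite -ltNge; lra.
  by rewrite (_ : 2 * 1 - 1 = 1 :> R)//; lra.
Qed.

Definition reparametrization L (p : R -> R) : Prop :=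
  [/\ continuous p, p 0 = 0, p 1 = 1 &
      forall s t : R, s < t ->
        p s < p t \/ (p s = p t /\ reflexive_order L)].

Lemma reparametrization_le L p s t : reparametrization L p -> s <= t -> p s <= p t.
Proof.
move=> [_ _ _ m]; rewrite le_eqVlt => /predU1P[->//|/m[/ltW//|[->//]]].
Qed.

Lemma reparametrization_itv L p t :
  reparametrization L p -> t \in `[0, 1] -> p t \in `[0, 1].
Proof.
move=> pr; rewrite !in_itv /= => /andP[t0 t1].
move: (reparametrization_le pr t0) (reparametrization_le pr t1).
by case: pr => _ -> -> _ -> ->.
Qed.

Lemma reparametrize_path L x y c p :
  reparametrization L p -> is_path L x y c -> is_path L x y (c \o p).
Proof.
move=> pr; have pI := reparametrization_itv pr; have ple := reparametrization_le pr.
case: pr => [cp p0 p1 pm] [cc oc c0 c1]; split.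
- by apply: within_comp cc => // t; exact: pI.
- move=> t0 t0I U oU Ut0.
  have [d d0 dP] := oc (p t0) (pI _ t0I) U oU Ut0.
  have Unear : \forall t \near t0, t \in `[0, 1] -> U (c (p t)).
    have /subspace_continuousP/(_ t0 t0I) cp' : {within `[0, 1]%classic, continuous (c \o p)}.
      by apply: within_comp cc => // t; exact: pI.
    exact: (cp' U (open_nbhs_nbhs (conj oU Ut0))).
  have pnear : \forall t \near t0, `|p t0 - p t| < d.
    by have /cvgrPdist_lt/(_ d d0) := cp t0.
  have : \forall t \near t0, `|p t0 - p t| < d /\ (t \in `[0, 1] -> U (c (p t))).
    by near=> t; split; near: t.
  move=> /nbhs_ballP[e /= e0 eP].
  have eP' t : t \in `]t0 - e, t0 + e[ ->
      (p t \in `]p t0 - d, p t0 + d[) /\ (t \in `[0, 1] -> U (c (p t))).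
    rewrite !in_itv /= => /andP[t1 t2].
    have [|ptd Ut] := eP t; first by rewrite /ball /= ltr_norml; apply/andP; split; lra.
    split=> //; move: ptd; rewrite ltr_norml => /andP[? ?].
    by apply/andP; split; lra.
  exists e => // s t se sI te tI st /=.
  have [ps Us] := eP' s se; have [pt _] := eP' t te.
  have [pst|[pst rL]] := pm s t st; last by rewrite -pst; apply: rL; exact: Us.
  by apply: dP => //; exact: pI.
- by rewrite /= p0.
- by rewrite /= p1.
Unshelve. all: by end_near.
Qed.

Lemma path_homotopy_refl L x y c : is_path L x y c -> path_homotopy L x y c c.
Proof.
move=> pc; exists (c \o snd); split => //.
apply: within_comp (let: And4 cc _ _ _ := pc in cc).
  by move=> ?; exact: cvg_snd.
by move=> t /= [].
Qed.

Lemma path_homotopy_reparametrize L x y c p : reparametrization L p ->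
  is_path L x y c -> path_homotopy L x y (c \o p) c.
Proof.
move=> pr pc; have pI := reparametrization_itv pr.
have qr (s : R) : s \in `[0, 1] ->
    reparametrization L (fun t => (1 - s) * p t + s * t).
  rewrite in_itv /= => /andP[s0 s1]; case: pr => [cp p0 p1 pm]; split.
  - move=> t; apply: cvgD; apply: cvgM; try exact: cvg_cst.
      exact: cp.
    exact: cvg_id.
  - by rewrite p0; lra.
  - by rewrite p1; lra.
  - move=> u v uv; have [puv|[puv rL]] := pm u v uv.
      left; have [->|sn1] := eqVneq s 1; first by lra.
      have ? : s < 1 by rewrite lt_neqAle sn1.
      apply: ltr_leD; last by rewrite ler_wpM2l// ltW.
      by rewrite ltr_pM2l//; lra.
    have [s00|sn0] := eqVneq s 0; last first.
      left; rewrite puv ltrD2l ltr_pM2l// lt_neqAle eq_sym sn0//.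
    by right; split=> //; rewrite s00 puv; lra.
exists (fun st => c ((1 - st.1) * p st.2 + st.1 * st.2)); split.
- apply: (within_comp (g := fun st : R * R => (1 - st.1) * p st.2 + st.1 * st.2))
    (let: And4 cc _ _ _ := pc in cc).
    move=> [s t]; have c1 : st.1 @[st --> (s, t)] --> s by exact: cvg_fst.
    have c2 : st.2 @[st --> (s, t)] --> t by exact: cvg_snd.
    apply: cvgD; apply: cvgM => //; first by apply: cvgB => //; exact: cvg_cst.
    by apply: cvg_comp c2 _; case: pr => cp _ _ _; exact: cp.
  move=> [s t] /= [sI tI]; exact: reparametrization_itv (qr s sI) tI.
- by move=> t tI /=; congr c; lra.
- by move=> t tI /=; congr c; lra.
- by move=> s sI; exact: reparametrize_path (qr s sI) pc.
Qed.

Lemma path_homotopy_sym L x y c0 c1 :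
  path_homotopy L x y c0 c1 -> path_homotopy L x y c1 c0.
Proof.
move=> [H [cH H0 H1 HP]]; exists (fun st => H (1 - st.1, st.2)); split.
- apply: (within_comp (g := fun st : R * R => (1 - st.1, st.2))) cH.
    apply: continuous_pair => st; last exact: cvg_snd.
    by apply: cvgB; [exact: cvg_cst|exact: cvg_fst].
  move=> [s t] /=; rewrite !in_itv /= => -[/andP[? ?] ?]; split=> //.
  by apply/andP; split; lra.
- by move=> t tI /=; rewrite subr0 H1.
- by move=> t tI /=; rewrite subrr H0.
- move=> s; rewrite in_itv /= => /andP[s0 s1]; apply: HP.
  by rewrite in_itv /=; apply/andP; split; lra.
Qed.

Lemma path_homotopy_trans L x y c0 c1 c2 :
  path_homotopy L x y c0 c1 -> path_homotopy L x y c1 c2 ->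
  path_homotopy L x y c0 c2.
Proof.
move=> [H [cH H0 H1 HP]] [K [cK K0 K1 KP]].
exists (fun st => if st.1 <= 2^-1 then H (2 * st.1, st.2)
                  else K (2 * st.1 - 1, st.2)); split.
- apply: (@within_paste R _ _ _ fst).
  + exact: closed_square.
  + by move=> ?; exact: cvg_fst.
  + apply: (within_comp (g := fun st : R * R => (2 * st.1, st.2))) cH.
      apply: continuous_pair => st; last exact: cvg_snd.
      by apply: cvgM; [exact: cvg_cst|exact: cvg_fst].
    move=> [s t] /=; rewrite !in_itv /= => -[[/andP[? ?] ?] ?]; split=> //.
    by apply/andP; split; lra.
  + apply: (within_comp (g := fun st : R * R => (2 * st.1 - 1, st.2))) cK.
      apply: continuous_pair => st; last exact: cvg_snd.
      apply: cvgB; last exact: cvg_cst.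
      by apply: cvgM; [exact: cvg_cst|exact: cvg_fst].
    move=> [s t] /=; rewrite !in_itv /= => -[[/andP[? ?] ?] ?]; split=> //.
    by apply/andP; split; lra.
  + move=> [s t] /= [_ tI] ->; rewrite (_ : 2 * 2^-1 = 1 :> R); last by lra.
    by rewrite subrr H1// K0.
- by move=> t tI /=; rewrite ifT ?invr_ge0// mulr0 H0.
- move=> t tI /=; rewrite ifF; last by apply/negbTE; rewrite -ltNge; lra.
  by rewrite (_ : 2 * 1 - 1 = 1 :> R) ?K1//; lra.
- move=> s; rewrite in_itv /= => /andP[s0 s1].
  have [sh|sh] := leP s 2^-1.
    by apply: HP; rewrite in_itv /=; apply/andP; split; lra.
  by apply: KP; rewrite in_itv /=; apply/andP; split; lra.
Qed.

Lemma path_homotopy_concat L x y z a0 a1 b0 b1 :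
  path_homotopy L x y a0 a1 -> path_homotopy L y z b0 b1 ->
  path_homotopy L x z (concat a0 b0) (concat a1 b1).
Proof.
move=> [H [cH H0 H1 HP]] [K [cK K0 K1 KP]].
exists (fun st => if st.2 <= 2^-1 then H (st.1, 2 * st.2)
                  else K (st.1, 2 * st.2 - 1)); split.
- apply: (@within_paste R _ _ _ snd).
  + exact: closed_square.
  + by move=> ?; exact: cvg_snd.
  + apply: (within_comp (g := fun st : R * R => (st.1, 2 * st.2))) cH.
      apply: continuous_pair => st; first exact: cvg_fst.
      by apply: cvgM; [exact: cvg_cst|exact: cvg_snd].
    move=> [s t] /=; rewrite !in_itv /= => -[[? /andP[? ?]] ?]; split=> //.
    by apply/andP; split; lra.
  + apply: (within_comp (g := fun st : R * R => (st.1, 2 * st.2 - 1))) cK.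
      apply: continuous_pair => st; first exact: cvg_fst.
      apply: cvgB; last exact: cvg_cst.
      by apply: cvgM; [exact: cvg_cst|exact: cvg_snd].
    move=> [s t] /=; rewrite !in_itv /= => -[[? /andP[? ?]] ?]; split=> //.
    by apply/andP; split; lra.
  + move=> [s t] /= [sI _] ->; rewrite (_ : 2 * 2^-1 = 1 :> R); last by lra.
    rewrite subrr; case: (HP s sI) => _ _ _ ->.
    by case: (KP s sI) => _ _ ->.
- move=> t; rewrite in_itv /= => /andP[t0 t1]; rewrite /concat.
  by case: ifPn => [|/negbTE]; rewrite ?[_ <= _ = false]leNgt => th;
    rewrite ?H0 ?K0// in_itv /=; apply/andP; split; lra.
- move=> t; rewrite in_itv /= => /andP[t0 t1]; rewrite /concat.
  by case: ifPn => th; rewrite ?H1 ?K1// in_itv /=; apply/andP; split; lra.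
- move=> s sI; exact: (concat_path (HP s sI) (KP s sI)).
Qed.

End paths.

Record lpath (R : realType) (X : topologicalType) (L : local_order X)
    (x y : X) : Type := Lpath {
  lpath_fun :> R -> X;
  lpathP : is_path L x y lpath_fun }.

HB.instance Definition _ R X L x y := gen_eqMixin (@lpath R X L x y).
HB.instance Definition _ R X L x y := gen_choiceMixin (@lpath R X L x y).

Section path_classes.
Context {R : realType} {X : topologicalType} (L : local_order X).
Implicit Types x y z : X.

Definition homotopic x y : rel (lpath R L x y) :=
  fun c0 c1 => `[< path_homotopy L x y c0 c1 >].

Lemma homotopic_equiv x y : equiv_class_of (@homotopic x y).
Proof.
split=> [c|c0 c1|c1 c0 c2].
- exact/asboolP/path_homotopy_refl/lpathP.
- by apply/asboolP/asboolP => /path_homotopy_sym.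
- move=> /asboolP c01 /asboolP c12; apply/asboolP.
  exact: path_homotopy_trans c01 c12.
Qed.

Canonical homotopic_equiv_rel x y := EquivRelPack (homotopic_equiv x y).

Definition path_class x y := {eq_quot homotopic_equiv_rel x y}.

Definition lconcat x y z (a : lpath R L x y) (b : lpath R L y z) :
    lpath R L x z :=
  Lpath (concat_path (lpathP a) (lpathP b)).

(* Computed on chosen representatives; class_comp_pi shows that the choice is
   immaterial. *)
Definition class_comp x y z (g : path_class y z) (f : path_class x y) :
    path_class x z :=
  \pi_(path_class x z) (lconcat (repr f) (repr g)).

Lemma path_class_eqP x y (c0 c1 : lpath R L x y) :
  \pi_(path_class x y) c0 = \pi_(path_class x y) c1 <-> path_homotopy L x y c0 c1.
Proof.
split=> [/eqquotP/asboolP//|c01]; apply/eqquotP; exact/asboolP.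
Qed.

Lemma class_comp_pi x y z (b : lpath R L y z) (a : lpath R L x y) :
  class_comp (\pi_(path_class y z) b) (\pi_(path_class x y) a) =
  \pi_(path_class x z) (lconcat a b).
Proof.
apply/path_class_eqP => /=; apply: path_homotopy_concat;
  by apply/path_class_eqP; rewrite reprK.
Qed.

Lemma class_compA w x y z (h : path_class y z) (g : path_class x y)
    (f : path_class w x) :
  class_comp h (class_comp g f) = class_comp (class_comp h g) f.
Proof.
rewrite -[h]reprK -[g]reprK -[f]reprK.
set c := repr h; set b := repr g; set a := repr f.
rewrite (class_comp_pi b a) (class_comp_pi c b) !class_comp_pi.
pose p := (fun t : R => 2 * t) \min ((fun t : R => t + 2^-1 / 2) \min (fun t : R => (t + 1) / 2)).
have pr : reparametrization L p.
  split.
  - have c1 : continuous (fun t : R => 2 * t).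
      by move=> t; apply: cvgM; [exact: cvg_cst|exact: cvg_id].
    have c2 : continuous (fun t : R => t + 2^-1 / 2).
      by move=> t; apply: cvgD; [exact: cvg_id|exact: cvg_cst].
    have c3 : continuous (fun t : R => (t + 1) / 2).
      move=> t; apply: cvgM; last exact: cvg_cst.
      by apply: cvgD; [exact: cvg_id|exact: cvg_cst].
    exact: min_fun_continuous c1 (min_fun_continuous c2 c3).
  - by rewrite /p /= !minElt; do 3?case: ifPn; rewrite -?leNgt; lra.
  - by rewrite /p /= !minElt; do 3?case: ifPn; rewrite -?leNgt; lra.
  - move=> s t st; left; rewrite /p /= !(lt_min, gt_min).
    by apply/and3P; split; apply/or3P; [apply: Or31|apply: Or32|apply: Or33]; lra.
apply/path_class_eqP => /=.
have := path_homotopy_reparametrize pr (lpathP (lconcat a (lconcat b c))).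
congr path_homotopy; apply/funext => t /=.
have [t4|t4] := leP t (2^-1 / 2).
  have -> : p t = 2 * t.
    by apply/min_idPl; rewrite le_min; apply/andP; split; lra.
  have h1 : 2 * t <= 2^-1 by lra.
  have h2 : t <= 2^-1 by lra.
  by rewrite /concat h1 h2.
have [t2|t2] := leP t 2^-1.
  have -> : p t = t + 2^-1 / 2.
    rewrite /p /= (min_idPr _); last by rewrite ge_min; apply/orP; left; lra.
    by apply/min_idPl; lra.
  rewrite /concat t2 ifF; last by apply/negbTE; rewrite -ltNge; lra.
  rewrite ifT; last by lra.
  rewrite ifF; last by apply/negbTE; rewrite -ltNge; lra.
  by congr (b _); lra.
have -> : p t = (t + 1) / 2.
  rewrite /p /= (min_idPr _); last by rewrite ge_min; apply/orP; left; lra.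
  by apply/min_idPr; lra.
rewrite /concat ifF; last by apply/negbTE; rewrite -ltNge; lra.
rewrite ifF; last by apply/negbTE; rewrite -ltNge; lra.
rewrite [in RHS]ifF; last by apply/negbTE; rewrite -ltNge; lra.
by congr (c _); lra.
Qed.

Definition path_semicategory : semicategory :=
  Semicategory (object := X) class_compA.

Context (rL : reflexive_order L).

Lemma cst_is_path x : is_path L x x (fun _ : R => x).
Proof.
split=> //; first by apply/subspace_continuousP => ? _; exact: cvg_cst.
by move=> t0 _ U oU Ux; exists 1 => //= *; exact: rL.
Qed.

Definition class_id x : path_class x x :=
  \pi_(path_class x x) (Lpath (cst_is_path x)).

Lemma class_comp1m x y (f : path_class x y) : class_comp (class_id y) f = f.
Proof.
rewrite -[f]reprK class_comp_pi; set a := repr f; apply/path_class_eqP => /=.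
have pr : reparametrization L ((fun t : R => 2 * t) \min (fun=> 1)).
  split=> /=.
  - apply: min_fun_continuous => t; last exact: cvg_cst.
    by apply: cvgM; [exact: cvg_cst|exact: cvg_id].
  - by rewrite mulr0; apply/min_idPl; lra.
  - by apply/min_idPr; lra.
  - move=> s t st; have [t1|t1] := leP 1 (2 * s).
      by right; split=> //; apply/esym/min_idPr; lra.
    by left; rewrite lt_min; apply/andP; split; lra.
have := path_homotopy_reparametrize pr (lpathP a).
congr path_homotopy; apply/funext => t /=; rewrite /concat.
have [t2|t2] := leP t 2^-1; first by congr (a _); apply/min_idPl; lra.
rewrite (min_idPr _); last by lra.
by case: (lpathP a).
Qed.

Lemma class_compm1 x y (f : path_class x y) : class_comp f (class_id x) = f.
Proof.
rewrite -[f]reprK class_comp_pi; set a := repr f; apply/path_class_eqP => /=.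
have pr : reparametrization L ((fun t : R => 2 * t - 1) \max (fun=> 0)).
  split=> /=.
  - apply: max_fun_continuous => t; last exact: cvg_cst.
    apply: cvgB; last exact: cvg_cst.
    by apply: cvgM; [exact: cvg_cst|exact: cvg_id].
  - by apply/max_idPr; lra.
  - by rewrite (max_idPl _); lra.
  - move=> s t st; have [t1|t1] := leP (2 * t - 1) 0.
      by right; split=> //; rewrite (max_idPr _) ?(max_idPr _)//; lra.
    by left; rewrite gt_max; apply/andP; split; lra.
have := path_homotopy_reparametrize pr (lpathP a).
congr path_homotopy; apply/funext => t /=; rewrite /concat.
have [t2|t2] := leP t 2^-1; last by congr (a _); apply/max_idPl; lra.
rewrite (max_idPr _); last by lra.
by case: (lpathP a).
Qed.

Definition path_category : category :=
  @Category path_semicategory class_id class_comp1m class_compm1.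

End path_classes.

Section smooth_functions.
Context {R : realType} {V W : normedModType R}.

(* For U open: f is C^0 if continuous, and C^{k+1} if differentiable with all
   directional derivatives C^k. *)
Fixpoint Ck_on (k : nat) (U : set V) (f : V -> W) : Prop :=
  if k is k'.+1 then
    (forall x, U x -> differentiable f x) /\ (forall v, Ck_on k' U ('D_v f))
  else forall x, U x -> {for x, continuous f}.

Definition smooth_on (U : set V) (f : V -> W) : Prop := forall k, Ck_on k U f.

End smooth_functions.

(* Homeomorphism from an open subset of X to an open subset of R^{n+1}; both
   directions are total functions, with irrelevant values outside. *)
Record chart (R : realType) (n : nat) (X : topologicalType) : Type := Chart {
  chart_fun :> X -> 'rV[R]_n.+1;
  chart_inv : 'rV[R]_n.+1 -> X;
  chart_dom : set X;
  chart_cod : set 'rV[R]_n.+1;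
  chart_dom_open : open chart_dom;
  chart_cod_open : open chart_cod;
  chart_fun_cod : forall x, chart_dom x -> chart_cod (chart_fun x);
  chart_inv_dom : forall u, chart_cod u -> chart_dom (chart_inv u);
  chart_funK : forall x, chart_dom x -> chart_inv (chart_fun x) = x;
  chart_invK : forall u, chart_cod u -> chart_fun (chart_inv u) = u;
  chart_fun_cont : {within chart_dom, continuous chart_fun};
  chart_inv_cont : {within chart_cod, continuous chart_inv} }.

Definition local_expr (R : realType) (n m : nat) (X Y : topologicalType)
    (c : chart R n X) (d : chart R m Y) (f : X -> Y) :
    'rV[R]_n.+1 -> 'rV[R]_m.+1 :=
  d \o f \o chart_inv c.

Definition local_dom (R : realType) (n m : nat) (X Y : topologicalType)
    (c : chart R n X) (d : chart R m Y) (f : X -> Y) : set 'rV[R]_n.+1 :=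
  [set u | chart_cod c u /\ chart_dom d (f (chart_inv c u))].

(* Manifolds have dimension n.+1. The atlas need not be maximal: it stands for
   the smooth structure that it generates. *)
Record smooth_manifold (R : realType) (n : nat) : Type := SmoothManifold {
  mcarrier :> topologicalType;
  atlas : set (chart R n mcarrier);
  manifold_hausdorff : hausdorff_space mcarrier;
  manifold_second_countable : @second_countable mcarrier;
  atlas_cover : forall x, exists2 c, atlas c & chart_dom c x;
  atlas_smooth : forall c d, atlas c -> atlas d ->
    smooth_on (local_dom c d id) (local_expr c d id) }.

(* Tangent vectors are row vectors of components in a chart and jacobian acts
   on the right: the differential of f at x maps v to v *m local_jacobian. *)
Definition local_jacobian (R : realType) (n m : nat) (X Y : topologicalType)
    (c : chart R n X) (d : chart R m Y) (f : X -> Y) (x : X) :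
    'M[R]_(n.+1, m.+1) :=
  jacobian (local_expr c d f) (c x).

(* Signature (-, +, ..., +): the rows of P form an orthonormal basis. *)
Definition lorentzian (R : realType) (n : nat) (G : 'M[R]_n.+1) : Prop :=
  G^T = G /\
  exists2 P : 'M[R]_n.+1, P \in unitmx &
    P *m G *m P^T = diag_mx (\row_i (if i == 0 then -1 else 1)).

Definition bilinear_form (R : realType) (n : nat) (G : 'M[R]_n.+1)
    (u v : 'rV[R]_n.+1) : R := (u *m G *m v^T) 0 0.

(* metric c x and time_field c x are the components at x, in the chart c, of
   the metric and of a continuous timelike vector field; they are meaningful
   for c in the atlas and x in its domain. The vector field defines the time
   orientation: the future cone at x is the one that contains it. *)
Record spacetime (R : realType) (n : nat) : Type := Spacetime {
  smanifold :> smooth_manifold R n;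
  metric : chart R n smanifold -> smanifold -> 'M[R]_n.+1;
  time_field : chart R n smanifold -> smanifold -> 'rV[R]_n.+1;
  metric_change : forall c d x,
    atlas c -> atlas d -> chart_dom c x -> chart_dom d x ->
    metric c x = local_jacobian c d id x *m metric d x *m (local_jacobian c d id x)^T;
  metric_smooth : forall c, atlas c ->
    smooth_on (chart_cod c) (metric c \o chart_inv c);
  metric_lorentzian : forall c x, atlas c -> chart_dom c x ->
    lorentzian (metric c x);
  time_field_change : forall c d x,
    atlas c -> atlas d -> chart_dom c x -> chart_dom d x ->
    time_field d x = time_field c x *m local_jacobian c d id x;
  time_field_cont : forall c, atlas c ->
    {within chart_dom c, continuous (time_field c)};
  time_field_timelike : forall c x, atlas c -> chart_dom c x ->
    bilinear_form (metric c x) (time_field c x) (time_field c x) < 0 }.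

(* Derivative at t of the restriction of f to A; one-sided at the ends of an
   interval. *)
Definition has_velocity (R : realType) (n : nat) (A : set R)
    (f : R -> 'rV[R]_n.+1) (t : R) (v : 'rV[R]_n.+1) : Prop :=
  (s - t)^-1 *: (f s - f t) @[s --> within A t^'] --> v.

Lemma has_velocityP (R : realType) (n : nat) (A : set R)
    (f : R -> 'rV[R]_n.+1) (t : R) (v : 'rV[R]_n.+1) :
  has_velocity A f t v <->
  forall W, nbhs v W ->
    nbhs t (fun s => s != t -> A s -> W ((s - t)^-1 *: (f s - f t))).
Proof. by split=> fv W /fv. Qed.

Section causality.
Context {R : realType} {n : nat} (X : spacetime R n).

Definition future_timelike (c : chart R n X) (x : X) (v : 'rV[R]_n.+1) : Prop :=
  bilinear_form (metric c x) v v < 0 /\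
  bilinear_form (metric c x) v (time_field c x) < 0.

Definition future_causal (c : chart R n X) (x : X) (v : 'rV[R]_n.+1) : Prop :=
  [/\ v != 0, bilinear_form (metric c x) v v <= 0 &
      bilinear_form (metric c x) v (time_field c x) < 0].

(* cone c x v: the vector at x with components v in the chart c is admissible. *)
Section curves.
Context (cone : chart R n X -> X -> 'rV[R]_n.+1 -> Prop).
Implicit Types (U : set X) (g : R -> X).

(* The restriction of g to [a, b] is a C^1 curve in U, one-sided derivatives at
   a and b included, all of whose velocities are admissible. *)
Definition C1_segment U g (a b : R) : Prop :=
  [/\ a < b, {within `[a, b]%classic, continuous g},
      {in `[a, b], forall t, U (g t)} &
      forall c : chart R n X, atlas c ->
      exists2 v : R -> 'rV[R]_n.+1,
        {within [set t | t \in `[a, b] /\ chart_dom c (g t)], continuous v} &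
        forall t, t \in `[a, b] -> chart_dom c (g t) ->
          has_velocity `[a, b]%classic (c \o g) t (v t) /\ cone c (g t) (v t)].

(* g on [a, last a s], with the consecutive elements of a :: s as break points. *)
Fixpoint piecewise_C1 U g (a : R) (s : seq R) : Prop :=
  if s is b :: s' then C1_segment U g a b /\ piecewise_C1 U g b s' else True.

Definition curve_joins U x y : Prop :=
  exists (g : R -> X) (a : R) (s : seq R),
    [/\ s <> [::], piecewise_C1 U g a s, g a = x & g (last a s) = y].

Lemma C1_segment_eq U g g' a b :
  {in `[a, b], g =1 g'} -> C1_segment U g a b -> C1_segment U g' a b.
Proof.
move=> e [ab cg Ug vg]; split=> //.
- apply: subspace_eq_continuous cg => t /set_mem /= tI.
  by rewrite /from_subspace e.
- by move=> t tI; rewrite -e//; exact: Ug.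
- move=> c cA; have [v cv vP] := vg c cA; exists v.
    rewrite (_ : mkset _ = [set t | t \in `[a, b] /\ chart_dom c (g t)])//.
    by apply/seteqP; split=> t /= [tI]; rewrite e.
  move=> t tI; rewrite -e// => ct; have [vt Pt] := vP t tI ct; split=> //.
  apply/has_velocityP => W /(proj1 (has_velocityP _ _ _ _) vt W).
  by apply: filterS => s /= sW st sI; rewrite -!e//; exact: sW.
Qed.

Lemma C1_segment_shift U g a b d :
  C1_segment U g a b -> C1_segment U (fun t => g (t - d)) (a + d) (b + d).
Proof.
have cd : continuous (fun t : R => t - d).
  by move=> t; apply: cvgB; [exact: cvg_id|exact: cvg_cst].
have sI t : t \in `[a + d, b + d] -> t - d \in `[a, b].
  by rewrite !in_itv /= lerBrDr lerBlDr.
move=> [ab cg Ug vg]; split.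
- by rewrite ltrD2r.
- by apply: (within_comp (g := fun t : R => t - d)) cg.
- by move=> t /sI; exact: Ug.
- move=> c cA; have [v cv vP] := vg c cA; exists (fun t => v (t - d)).
    by apply: (within_comp (g := fun t : R => t - d)) cv => // t /= [/sI].
  move=> t /sI tI ct; have [vt Pt] := vP _ tI ct; split=> //.
  apply/has_velocityP => W /(proj1 (has_velocityP _ _ _ _) vt W) tW.
  have : nbhs t ((fun s => s - d) @^-1` _) := cd t _ tW.
  apply: filterS => s /= sW st sId.
  have -> : s - t = (s - d) - (t - d) by lra.
  by apply: sW; [apply: contra_neq st; lra|exact: sI].
Qed.

Lemma piecewise_C1_eq U g g' a s :
  {in `[a, last a s], g =1 g'} -> piecewise_C1 U g a s -> piecewise_C1 U g' a s.
Proof.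
have le_last : forall s a, piecewise_C1 U g a s -> a <= last a s.
  elim=> [a' _|b s' IH a' [[ab _ _ _] /IH]] //=.
  by apply: le_trans; exact: ltW.
elim: s a => [//|b s IH] a /= e [gab gs]; split.
  apply: C1_segment_eq gab => t tI; apply: e.
  move: tI; rewrite !in_itv /= => /andP[-> /le_trans]; apply.
  exact: le_last.
case: (gab) => ab _ _ _.
apply: IH gs => t; rewrite in_itv /= => /andP[t1 t2]; apply: e.
by rewrite in_itv /= t2 (le_trans (ltW ab)).
Qed.

Lemma piecewise_C1_shift U g a s d : piecewise_C1 U g a s ->
  piecewise_C1 U (fun t => g (t - d)) (a + d) (map (+%R^~ d) s).
Proof.
elim: s a => [//|b s IH] a /= [gab gs]; split; first exact: C1_segment_shift.
exact: IH.
Qed.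

Lemma piecewise_C1_cat U g a s s' :
  piecewise_C1 U g a s -> piecewise_C1 U g (last a s) s' ->
  piecewise_C1 U g a (s ++ s').
Proof.
elim: s a => [//|b s IH] a /= [gab gs] gs'; split=> //; exact: IH.
Qed.

Lemma curve_joins_trans U x y z :
  curve_joins U x y -> curve_joins U y z -> curve_joins U x z.
Proof.
move=> [g [a [s [s0 gs ga gl]]]] [h [a' [s' [_ hs ha hl]]]].
pose d := last a s - a'.
exists (fun t => if t <= last a s then g t else h (t - d)), a.
have le_last k : forall s b, piecewise_C1 U k b s -> b <= last b s.
  elim=> [b _|b' s1 IH b [[ab _ _ _] /IH]] //=.
  by apply: le_trans; exact: ltW.
have lastd b r : last (b + d) (map (+%R^~ d) r) = last b r + d.
  exact: (last_map (+%R^~ d)).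
have dE : a' + d = last a s by rewrite /d addrC subrK.
exists (s ++ map (+%R^~ d) s'); split.
- by case: (s) s0.
- apply: piecewise_C1_cat.
    by apply: piecewise_C1_eq gs => t; rewrite in_itv /= => /andP[_ ->].
  rewrite -dE; apply: piecewise_C1_eq (piecewise_C1_shift d hs) => t.
  rewrite in_itv /= => /andP[t1 _]; case: ifPn => // t2.
  have -> : t = last a s by apply/eqP; rewrite eq_le -{2}dE t1 -dE t2.
  by rewrite gl -ha; congr h; rewrite /d; lra.
- by rewrite (le_last g)// ga.
- rewrite last_cat -dE lastd; case: ifPn => [lle|_]; last by rewrite addrK.
  have e : last a' s' = a'.
    by apply/eqP; rewrite eq_le (le_last h)// andbT -(lerD2r d).
  by rewrite e dE gl -hl e ha.
Qed.

End curves.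

Definition chron_before (U : set X) (x y : X) : Prop :=
  curve_joins future_timelike U x y.

Definition causally_before (U : set X) (x y : X) : Prop :=
  (U x /\ x = y) \/ curve_joins future_causal U x y.

Lemma causally_before_trans U x y z :
  causally_before U x y -> causally_before U y z -> causally_before U x z.
Proof.
move=> [[_ ->]//|xy] [[_ <-]|yz]; right=> //; exact: curve_joins_trans xy yz.
Qed.

Definition chronological_order : local_order X :=
  LocalOrder (@curve_joins_trans future_timelike).

Definition causal_order : local_order X := LocalOrder causally_before_trans.

Lemma causal_order_refl : reflexive_order causal_order.
Proof. by move=> U x Ux; left. Qed.

Definition Pi_t : semicategory := @path_semicategory R X chronological_order.

Definition Pi_c : category := @path_category R X causal_order causal_order_refl.

End causality.

Section diffeomorphisms.
Context {R : realType} {n m : nat}.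

Definition smooth_map (p q : nat) (X : smooth_manifold R p)
    (Y : smooth_manifold R q) (f : X -> Y) : Prop :=
  continuous f /\
  forall (c : chart R p X) (d : chart R q Y), atlas c -> atlas d ->
    smooth_on (local_dom c d f) (local_expr c d f).

Definition diffeomorphism (X : smooth_manifold R n) (Y : smooth_manifold R m)
    (f : X -> Y) : Prop :=
  smooth_map f /\
  exists f' : Y -> X, [/\ cancel f f', cancel f' f & smooth_map f'].

Definition smooth_function (X : smooth_manifold R n) (w : X -> R) : Prop :=
  forall c : chart R n X, atlas c ->
    smooth_on (chart_cod c) (w \o chart_inv c : 'rV[R]_n.+1 -> R^o).

(* In charts, the matrix of the pullback of the metric of Y is J h J^T. *)
Definition conformal_diffeomorphism (X : spacetime R n) (Y : spacetime R m)
    (f : X -> Y) : Prop :=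
  diffeomorphism f /\
  exists w : X -> R,
    [/\ forall x, 0 < w x, smooth_function w &
        forall (c : chart R n X) (d : chart R m Y) (x : X),
          atlas c -> atlas d -> chart_dom c x -> chart_dom d (f x) ->
          local_jacobian c d f x *m metric d (f x) *m (local_jacobian c d f x)^T
          = w x *: metric c x].

End diffeomorphisms.

(* Main.v *)
Require Import Defs.
From mathcomp Require Import all_boot all_order all_algebra.
From mathcomp Require Import all_classical all_reals.
From mathcomp Require Import topology normedtype derive.
From mathcomp Require Import generic_quotient landau.
From mathcomp Require Import ring lra.

(* Let c be a causal path in a small chart ball. A linear functional that is
   positive on the causal cones over the ball bounds the displacement along a
   causal path by its value on the displacement between the end points, so no path
   homotopic to c leaves the ball. A point z on a path representing F [c] factors
   F [c], hence its preimage lies on a path homotopic to c; so F [c] is represented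
   by a path that stays near f (c 0), where f is the object map of F. A functional
   positive on the causal cone at f (c 0) is positive on the nearby cones, hence
   nondecreasing along that path; letting c shrink, the differential of f maps
   timelike vectors to causal ones. The same holds for the inverse of f, so null
   vectors correspond, and a Lorentzian form is determined by its null vectors up
   to a factor. *)

Set Implicit Arguments.
Unset Strict Implicit.
Unset Printing Implicit Defensive.
Import Order.TTheory GRing.Theory Num.Theory.
Import numFieldNormedType.Exports.
Local Open Scope classical_set_scope.
Local Open Scope ring_scope.
Local Open Scope quotient_scope.

(** * Lorentzian forms *)

(** Without a causality condition any two points may be joined by timelike paths, so the mere
    existence of a morphism says nothing about the local order; the information sits in the homotopy
    classes, and this is why homotopies have to be confined. An isomorphism acts on classes and
    transports neither paths nor homotopies. What it does transport is the statement that a point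
    lies on some representative of a class, because for interior points this is a factorization
    through that object. Both cases are handled together: [LX] and [LY] are local orders between the
    chronological and the causal one, so that straight timelike segments are admissible and all
    admissible paths and homotopies are causal. Since a derivative is a limit, only closed
    conditions survive: a timelike vector is known to go to a causal one, possibly null. The algebra
    lives with these weak inclusions, and the strict positivity of the factor comes at the end from
    the invertibility of the differential. *)

Section lorentzian_algebra.
Context {R : realType} {n : nat}.
Implicit Types (G P : 'M[R]_n.+1) (u v w t : 'rV[R]_n.+1) (a b : R).

Lemma bilinear_formDl G u v w :
  bilinear_form G (u + v) w = bilinear_form G u w + bilinear_form G v w.
Proof. by rewrite /bilinear_form !mulmxDl mxE. Qed.

Lemma bilinear_formDr G u v w :
  bilinear_form G u (v + w) = bilinear_form G u v + bilinear_form G u w.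
Proof. by rewrite /bilinear_form linearD /= mulmxDr mxE. Qed.

Lemma bilinear_formZl G a u v : bilinear_form G (a *: u) v = a * bilinear_form G u v.
Proof. by rewrite /bilinear_form -!scalemxAl mxE. Qed.

Lemma bilinear_formZr G a u v : bilinear_form G u (a *: v) = a * bilinear_form G u v.
Proof. by rewrite /bilinear_form linearZ /= -scalemxAr mxE. Qed.

Lemma bilinear_formC G u v : G^T = G -> bilinear_form G u v = bilinear_form G v u.
Proof.
move=> Gs; rewrite /bilinear_form -[u *m G *m v^T]trmxK mxE.
by rewrite !trmx_mul trmxK Gs mulmxA.
Qed.

Lemma bilinear_form_congr (m : nat) (J : 'M[R]_(n.+1, m.+1)) (H : 'M[R]_m.+1) u v :
  bilinear_form (J *m H *m J^T) u v = bilinear_form H (u *m J) (v *m J).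
Proof. by rewrite /bilinear_form trmx_mul !mulmxA. Qed.

Definition bilinear_formE :=
  (bilinear_formDl, bilinear_formDr, bilinear_formZl, bilinear_formZr).

Lemma bilinear_form_row G P i j :
  bilinear_form G (row i P) (row j P) = (P *m G *m P^T) i j.
Proof.
rewrite /bilinear_form -row_mul tr_row -[P^T in RHS]trmxK.
rewrite !mxE; apply: eq_bigr => k _; by rewrite !mxE.
Qed.

(** The functional [a] reads off the coefficient of the negative vector of an orthonormal basis; on
    its kernel the form is the sum of the squares of the other coefficients. *)
Lemma lorentzian_hyperplane G : lorentzian G ->
  exists a : 'cV[R]_n.+1, forall u, (u *m a) 0 0 = 0 ->
    0 <= bilinear_form G u u ?= iff (u == 0).
Proof.
move=> [Gs [P Pu PGP]]; exists (col 0 (invmx P)) => u u0.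
have [y yE uE] : exists2 y, y = u *m invmx P & u = y *m P.
  by exists (u *m invmx P); rewrite ?mulmxKV.
have y0 : y 0 0 = 0 by move: u0; rewrite colE mulmxA -yE -colE => <-; rewrite [in RHS]mxE.
have QE : bilinear_form G u u = \sum_i y 0 i ^+ 2.
  rewrite uE -bilinear_form_congr PGP /bilinear_form mul_mx_diag mxE.
  apply: eq_bigr => i _; rewrite !mxE; case: eqP => [->|_]; first by rewrite y0; ring.
  by ring.
rewrite QE; split; first by apply: sumr_ge0 => i _; exact: sqr_ge0.
rewrite eq_sym psumr_eq0; last by move=> i _; exact: sqr_ge0.
apply/allP/eqP => [yi|u00 i _]; last by rewrite /= yE u00 mul0mx mxE expr0n eqxx.
rewrite uE (_ : y = 0) ?mul0mx//; apply/rowP => i; rewrite mxE.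
by have := yi i (mem_index_enum _); rewrite sqrf_eq0 => /eqP.
Qed.

(** There is only one negative direction: otherwise [u] and [w] would span a plane on which the form
    is nonpositive, and a plane meets the hyperplane of [lorentzian_hyperplane] in a nonzero
    vector. *)
Lemma timelike_orthogonal G w u : lorentzian G ->
  bilinear_form G w w < 0 -> bilinear_form G u w = 0 ->
  bilinear_form G u u <= 0 -> u = 0.
Proof.
move=> LG ww uw uu; have Gs := LG.1.
have [a aP] := lorentzian_hyperplane LG.
pose z := (u *m a) 0 0 *: w - (w *m a) 0 0 *: u.
have z0 : (z *m a) 0 0 = 0.
  by rewrite /z mulmxBl -!scalemxAl !mxE; ring.
have [zz _] := aP z z0.
have zE : bilinear_form G z z = (u *m a) 0 0 ^+ 2 * bilinear_form G w w
    + (w *m a) 0 0 ^+ 2 * bilinear_form G u u.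
  rewrite /z -scaleNr !bilinear_formE (bilinear_formC w u Gs) uw; ring.
have [u0|u0] := eqVneq ((u *m a) 0 0) 0.
  have [uu' /esym] := aP u u0; have -> : bilinear_form G u u = 0 by lra.
  by rewrite eqxx => /eqP.
have A0 : (u *m a) 0 0 ^+ 2 * bilinear_form G w w < 0.
  by rewrite pmulr_rlt0// exprn_even_gt0.
have B0 : (w *m a) 0 0 ^+ 2 * bilinear_form G u u <= 0.
  by rewrite mulr_ge0_le0// sqr_ge0.
by rewrite {}zE in zz; exfalso; lra.
Qed.

(** If [v] paired nonnegatively with [w], the combination [z] of [w] and [t] orthogonal to [v] would
    have nonnegative coefficients and hence be timelike, forcing [v = 0]. This takes the place of
    the reverse Cauchy-Schwarz inequality. *)
Lemma causal_timelike_lt0 G w t v : lorentzian G ->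
  bilinear_form G w w < 0 -> bilinear_form G t t < 0 -> bilinear_form G w t < 0 ->
  v != 0 -> bilinear_form G v v <= 0 -> bilinear_form G v t <= 0 ->
  bilinear_form G v w < 0.
Proof.
move=> LG ww tt wt v0 vv vt; have Gs := LG.1.
have vt0 : bilinear_form G v t < 0.
  rewrite lt_neqAle vt andbT; apply: contra_neq v0 => vt0.
  exact: timelike_orthogonal tt vt0 vv.
rewrite ltNge; apply: contra_neqN v0 => vw.
pose z := (- bilinear_form G v t) *: w + bilinear_form G v w *: t.
apply: (@timelike_orthogonal G z) => //; rewrite /z !bilinear_formE; last by ring.
rewrite (bilinear_formC t w Gs).
have xx : bilinear_form G v t ^+ 2 * bilinear_form G w w < 0.
  by rewrite pmulr_rlt0// exprn_even_gt0//= lt_eqF.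
have yy : 0 <= bilinear_form G v w ^+ 2 by exact: sqr_ge0.
have xy : 0 <= - (bilinear_form G v t * bilinear_form G v w).
  by rewrite oppr_ge0 mulr_le0_ge0// ltW.
have := mulr_ge0_le0 yy (ltW tt).
have := mulr_ge0_le0 xy (ltW wt); nra.
Qed.

Lemma affine_lt0_near a b : a < 0 -> exists2 e : R, 0 < e <= 1 & a + e * b < 0.
Proof.
move=> a0; pose e := - a / (1 - a + `|b|).
have b0 := normr_ge0 b; have bb := ler_norm b.
have d0 : 0 < 1 - a + `|b| by lra.
have e0 : 0 < e by rewrite divr_gt0//; lra.
have e1 : e <= 1 by rewrite ler_pdivrMr//; lra.
have eE : e * (1 - a + `|b|) = - a by rewrite /e mulfVK// gt_eqF.
by exists e; [rewrite e0 e1|nra].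
Qed.

Lemma quadratic_lt0_near a b c : a < 0 ->
  forall d, 0 < d -> exists2 e : R, 0 < e < d & a + e * b + e ^+ 2 * c < 0.
Proof.
move=> a0 d d0; have [e /andP[e0 e1] eP] := affine_lt0_near (`|b| + `|c|) a0.
have b0 := normr_ge0 b; have bb := ler_norm b.
have c0 := normr_ge0 c; have cc := ler_norm c.
pose f := Num.min e (d / 2).
have f0 : 0 < f by rewrite lt_min e0 divr_gt0.
have fe : f <= e by rewrite ge_min lexx.
have fd : f <= d / 2 by rewrite ge_min lexx orbT.
exists f; first by apply/andP; split; lra.
have f2 : f ^+ 2 <= f by rewrite expr2; nra.
have f20 : 0 <= f ^+ 2 by rewrite sqr_ge0.
nra.
Qed.

(** Up to sign, the closed future cone is its own dual. If [u] were spacelike, the component [w0] of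
    [t] orthogonal to [u] would be timelike in the cone of [t], and moving it slightly towards [u]
    would make its pairing with [u] positive. *)
Lemma causal_of_future_dual G t u : lorentzian G ->
  bilinear_form G t t < 0 ->
  (forall w, bilinear_form G w w < 0 -> bilinear_form G w t < 0 ->
     bilinear_form G w u <= 0) ->
  bilinear_form G u u <= 0.
Proof.
move=> [Gs _] tt wu; rewrite leNgt; apply/negP => uu.
have [w0 w0E] : exists w0, w0 = t + (- (bilinear_form G t u / bilinear_form G u u)) *: u.
  by eexists.
have w0u : bilinear_form G w0 u = 0.
  by rewrite w0E !bilinear_formE mulNr mulfVK ?subrr// gt_eqF.
have w0t : bilinear_form G w0 t = bilinear_form G t t - bilinear_form G t u ^+ 2 / bilinear_form G u u.
  by rewrite w0E !bilinear_formE (bilinear_formC u t Gs); ring.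
have w0w0 : bilinear_form G w0 w0 = bilinear_form G w0 t.
  by rewrite {2}w0E !bilinear_formE w0u; ring.
have w0t0 : bilinear_form G w0 t < 0.
  by rewrite w0t; have := divr_ge0 (sqr_ge0 (bilinear_form G t u)) (ltW uu); lra.
have [e /andP[e0 e1]] := affine_lt0_near (`|bilinear_form G u t| + bilinear_form G u u) w0t0.
have n0 := normr_ge0 (bilinear_form G u t); have nn := ler_norm (bilinear_form G u t).
move=> eP; suff : bilinear_form G (w0 + e *: u) u <= 0.
  by rewrite !bilinear_formE w0u; nra.
apply: wu; rewrite !bilinear_formE ?(bilinear_formC u w0 Gs) ?w0w0 ?w0u; nra.
Qed.

Section quadric_inclusions.
Variables (G H : 'M[R]_n.+1).
Hypothesis Gs : G^T = G.
Hypothesis Hs : H^T = H.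
Hypothesis GH : forall v, bilinear_form G v v < 0 -> bilinear_form H v v <= 0.
Hypothesis HG : forall v, bilinear_form H v v < 0 -> bilinear_form G v v <= 0.

(** [z] is on the boundary of the cone: for small [a > 0] the vector [z + a e] is timelike and
    [z - a e] spacelike for [G]. By continuity, a positive value of [H] at [z] contradicts [GH] on
    the inner side, and a negative one contradicts [HG] on the outer side. *)
Lemma null_of_inclusions e z :
  bilinear_form G e e < 0 -> bilinear_form G z e < 0 -> bilinear_form G z z = 0 ->
  bilinear_form H z z = 0.
Proof.
move=> ee ze zz.
have HE a : bilinear_form H (z + a *: e) (z + a *: e) =
    bilinear_form H z z + a * (2 * bilinear_form H z e) + a ^+ 2 * bilinear_form H e e.
  by rewrite !bilinear_formE (bilinear_formC e z Hs); ring.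
have GE a : bilinear_form G (z + a *: e) (z + a *: e) =
    a * (2 * bilinear_form G z e) + a ^+ 2 * bilinear_form G e e.
  by rewrite !bilinear_formE (bilinear_formC e z Gs) zz; ring.
apply/eqP; rewrite eq_le; apply/andP; split; rewrite leNgt; apply/negP => Hz.
  have [||a /andP[a0 _] aP] := @quadratic_lt0_near (- bilinear_form H z z)
      (- (2 * bilinear_form H z e)) (- bilinear_form H e e) _ 1 _; [lra|lra|].
  have /GH : bilinear_form G (z + a *: e) (z + a *: e) < 0.
    by rewrite GE expr2; nra.
  by rewrite HE; lra.
(* Below this threshold the linear term of [GE] at [- a] outweighs the quadratic one, so [z - a e]
   is spacelike for [G]. *)
have d0 : 0 < bilinear_form G z e / bilinear_form G e e by rewrite nmulr_rgt0// invr_lt0.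
have [a /andP[a0 ad] aP] := @quadratic_lt0_near (bilinear_form H z z)
  (- (2 * bilinear_form H z e)) (bilinear_form H e e) Hz _ d0.
have : bilinear_form H (z + (- a) *: e) (z + (- a) *: e) < 0 by rewrite HE; lra.
move=> /HG; rewrite GE sqrrN.
have : bilinear_form G z e < a * bilinear_form G e e.
  by rewrite -ltr_ndivlMr.
by rewrite expr2; nra.
Qed.

(** The null vectors [e 0 + e i] and [e 0 - e i] determine the first row and the diagonal of [H] in
    an orthonormal basis of [G]; null vectors with two spatial components determine the rest. The
    factor may vanish here, since [H = 0] satisfies both inclusions. *)
Lemma conformal_of_inclusions : lorentzian G ->
  exists2 w : R, 0 <= w & H = w *: G.
Proof.
move=> [_ [P Pu PGP]].
pose e i := row i P; pose B i j := bilinear_form H (e i) (e j).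
have Ge i j : bilinear_form G (e i) (e j) = ((i == j)%:R * (if i == 0 then -1 else 1)).
  by rewrite bilinear_form_row PGP !mxE; case: (i == j); rewrite ?mulr1n ?mulr0n ?mul1r ?mul0r.
have G00 : bilinear_form G (e 0) (e 0) = -1 by rewrite Ge !eqxx mul1r.
have BC i j : B i j = B j i by exact: bilinear_formC.
have Gi i : i != 0 -> (bilinear_form G (e i) (e i) = 1) *
    ((bilinear_form G (e i) (e 0) = 0) * (bilinear_form G (e 0) (e i) = 0)).
  by move=> i0; rewrite !Ge eqxx (eq_sym 0 i) (negbTE i0) mul1r !mul0r.
have Bp i : i != 0 -> B 0 i = 0 /\ B i i = - B 0 0.
  move=> i0.
  have p s : s ^+ 2 = 1 -> bilinear_form H (e 0 + s *: e i) (e 0 + s *: e i) = 0.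
    rewrite expr2 => s1; apply: (@null_of_inclusions (e 0)); rewrite ?G00//; first lra.
      by rewrite !bilinear_formE G00 !(Gi i i0); lra.
    by rewrite !bilinear_formE G00 !(Gi i i0); nra.
  have := p 1 (expr1n _ _); have := p (-1) (etrans (sqrrN _) (expr1n _ _)); rewrite !bilinear_formE.
  by rewrite -!/(B _ _) (BC i 0); split; lra.
have Bij i j : i != 0 -> j != 0 -> i != j -> B i j = 0.
  move=> i0 j0 ij.
  have Gij : bilinear_form G (e i) (e j) = 0 by rewrite Ge (negbTE ij) mul0r.
  (* null since [3 ^ 2 + 4 ^ 2 = 5 ^ 2] *)
  have : bilinear_form H (5 *: e 0 + (3 *: e i + 4 *: e j)) (5 *: e 0 + (3 *: e i + 4 *: e j)) = 0.
    apply: (@null_of_inclusions (e 0)); rewrite ?G00//; first lra.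
      by rewrite !bilinear_formE G00 !(Gi i i0) !(Gi j j0); lra.
    rewrite !bilinear_formE (bilinear_formC (e j) (e i) Gs) Gij G00 !(Gi i i0) !(Gi j j0).
    lra.
  rewrite !bilinear_formE -!/(B _ _) (BC i 0) (BC j 0) (BC j i).
  have [-> ->] := Bp i i0; have [-> ->] := Bp j j0; lra.
have B00 : B 0 0 <= 0 by apply: GH; rewrite G00; lra.
exists (- B 0 0); first by lra.
suff PH : P *m H *m P^T = P *m (- B 0 0 *: G) *m P^T.
  have PTu : P^T \in unitmx by rewrite unitmx_tr.
  have := congr1 (fun M => invmx P *m (M *m invmx P^T)) PH.
  by rewrite !mulmxK// !mulKmx.
rewrite -scalemxAr -scalemxAl PGP; apply/matrixP => i j.
rewrite -bilinear_form_row -/(e i) -/(e j) -/(B i j) !mxE.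
have [->|i0] := eqVneq i 0; have [->|j0] := eqVneq j 0; rewrite ?eqxx.
- by rewrite mulr1n; ring.
- by rewrite (Bp j j0).1 mulr0n mulr0.
- by rewrite BC (Bp i i0).1 (negbTE i0) mulr0n mulr0.
have [->|ij] := eqVneq i j; last by rewrite Bij// mulr0n mulr0.
by rewrite (Bp j j0).2 mulr1n mulr1.
Qed.

End quadric_inclusions.
End lorentzian_algebra.

(** * Calculus of C^k functions *)

Section local_differentiability.
Context {R : realType} {V W : normedModType R}.

Lemma near_eq_diff (f g : V -> W) x : (\near x, f x = g x) ->
  differentiable f x -> differentiable g x /\ 'd g x = 'd f x :> (V -> W).
Proof.
move=> fg df; have cdf := @diff_continuous _ _ _ _ _ df.
have gE : g \o shift x = cst (g x) + 'd f x +o_ 0 id.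
  apply/eqaddoP => e e0; have := diff_locally df.
  move=> /eqaddoP/(_ e e0).
  have : \forall h \near 0, f (h + x) = g (h + x).
    by move/nbhs0P: (fg); apply: filterS => h; rewrite addrC.
  by apply: filterS2 => h /= E; rewrite !fctE /= -(nbhs_singleton fg) -E.
have dE := diff_unique cdf gE.
by split=> //; apply/diff_locallyP; rewrite dE.
Qed.

End local_differentiability.

Section Ck_calculus.
Context {R : realType}.
Implicit Types V W : normedModType R.

Lemma Ck_on_lower V W k (U : set V) (f : V -> W) : Ck_on k.+1 U f -> Ck_on k U f.
Proof.
elim: k f => [|k IH] f [df Df].
  by move=> x /df; exact: differentiable_continuous.
by split=> // v; exact: IH.
Qed.

Lemma Ck_on_subset V W k (U U' : set V) (f : V -> W) : U' `<=` U ->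
  Ck_on k U f -> Ck_on k U' f.
Proof.
move=> UU'; elim: k f => [|k IH] f; first by move=> cf x /UU' /cf.
by move=> [df Df]; split=> [x /UU'|v]; [exact: df|exact: IH (Df v)].
Qed.

Lemma open_near_eq V W (U : set V) (f g : V -> W) x : open U ->
  (forall y, U y -> f y = g y) -> U x -> \near x, f x = g x.
Proof. by move=> oU fg Ux; apply: filterS (open_nbhs_nbhs (conj oU Ux)). Qed.

Lemma Ck_on_eq V W k (U : set V) (f g : V -> W) : open U ->
  (forall x, U x -> f x = g x) -> Ck_on k U f -> Ck_on k U g.
Proof.
move=> oU; elim: k f g => [|k IH] f g fg.
  move=> cf x Ux; have fgx := open_near_eq oU fg Ux.
  suff : g y @[y --> x] --> f x by rewrite (fg x Ux).
  apply: cvg_trans (cf x Ux).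
  by apply: near_eq_cvg; exact: fgx.
move=> [df Df]; split=> [x Ux|v].
  exact: (near_eq_diff (open_near_eq oU fg Ux) (df x Ux)).1.
apply: IH (Df v) => x Ux; apply: near_eq_derive; exact: open_near_eq Ux.
Qed.

Lemma Ck_on_local V W k (U : set V) (f : V -> W) :
  (forall x, U x -> exists2 U' : set V, U' x & Ck_on k U' f) -> Ck_on k U f.
Proof.
elim: k f => [|k IH] f Uf; first by move=> x /Uf[U' U'x /(_ x U'x)].
split=> [x /Uf[U' U'x [df _]]|v]; first exact: df.
by apply: IH => x /Uf[U' U'x [_ /(_ v)]]; exists U'.
Qed.

Lemma Ck_on_cst V W k (U : set V) (a : W) : Ck_on k U (fun _ : V => a).
Proof.
elim: k a => [|k IH] a; first by move=> x _; exact: cvg_cst.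
split=> [x _|v]; first exact: differentiable_cst.
rewrite (_ : 'D_v _ = fun=> 0) //; apply/funext => x.
by rewrite deriveE ?diff_cst//; exact: differentiable_cst.
Qed.

Lemma Ck_on_add V W k (U : set V) (f g : V -> W) : open U ->
  Ck_on k U f -> Ck_on k U g -> Ck_on k U (fun x => f x + g x).
Proof.
move=> oU; elim: k f g => [|k IH] f g.
  by move=> cf cg x Ux; apply: cvgD; [exact: cf|exact: cg].
move=> [df Df] [dg Dg]; split=> [x Ux|v].
  by apply: (differentiableD (df x Ux) (dg x Ux)).
apply: Ck_on_eq (IH _ _ (Df v) (Dg v)) => // x Ux.
by rewrite -deriveD//; apply: diff_derivable; [exact: df|exact: dg].
Qed.

Lemma Ck_on_sum V W k (U : set V) (I : Type) (s : seq I) (f : I -> V -> W) : open U ->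
  (forall i, Ck_on k U (f i)) -> Ck_on k U (fun x => \sum_(i <- s) f i x).
Proof.
move=> oU Cf; elim: s => [|i s IH].
  by apply: Ck_on_eq (Ck_on_cst k U 0) => // x _; rewrite big_nil.
by apply: Ck_on_eq (Ck_on_add oU (Cf i) IH) => // x _; rewrite big_cons.
Qed.

Lemma Ck_on_mul V k (U : set V) (f g : V -> R^o) : open U ->
  Ck_on k U f -> Ck_on k U g -> Ck_on k U (fun x => f x * g x : R^o).
Proof.
move=> oU; elim: k f g => [|k IH] f g.
  by move=> cf cg x Ux; apply: (cvgM (cf x Ux) (cg x Ux)).
move=> Cf Cg; have Cf' := Ck_on_lower Cf; have Cg' := Ck_on_lower Cg.
case: Cf Cg => [df Df] [dg Dg]; split=> [x Ux|v].
  by apply: (differentiableM (df x Ux) (dg x Ux)).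
apply: Ck_on_eq (Ck_on_add oU (IH _ _ Cf' (Dg v)) (IH _ _ Cg' (Df v))) => // x Ux.
rewrite -[RHS]/('D_v (f * g) x) deriveM//; apply: diff_derivable; [exact: df|exact: dg].
Qed.

Lemma Ck_on_inv V k (U : set V) (f : V -> R^o) : open U ->
  (forall x, U x -> f x != 0) -> Ck_on k U f -> Ck_on k U (fun x => (f x)^-1 : R^o).
Proof.
move=> oU f0; elim: k => [|k IH].
  by move=> cf x Ux; apply: (cvgV (f0 x Ux) (cf x Ux)).
move=> Cf; have Ci := IH (Ck_on_lower Cf).
case: Cf => [df Df]; split=> [x Ux|v].
  by apply: (differentiableV (df x Ux) (f0 x Ux)).
apply: Ck_on_eq (Ck_on_mul oU (Ck_on_mul oU (Ck_on_cst k U (-1 : R^o)) (Ck_on_mul oU Ci Ci)) (Df v)) => // x Ux.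
rewrite deriveV ?f0//; last by apply: diff_derivable; exact: df.
by rewrite /GRing.scale /= -exprVn expr2 mulN1r.
Qed.

Lemma Ck_on_coord V k (U : set V) p q (f : V -> 'M[R]_(p.+1, q.+1)) i j : open U ->
  Ck_on k U f -> Ck_on k U (fun x => f x i j : R^o).
Proof.
move=> oU; elim: k f => [|k IH] f.
  move=> cf x Ux.
  exact: (continuous_comp (cf x Ux) (@coord_continuous R _ _ i j (f x))).
move=> [df Df]; split=> [x Ux|v].
  exact: (differentiable_comp (df x Ux) (@differentiable_coord _ _ _ (f x) i j)).
apply: Ck_on_eq (IH _ (Df v)) => // x Ux.
by rewrite derive_mx ?mxE//; apply: diff_derivable; exact: df.
Qed.

(** The inner derivative is expanded in the standard basis because it varies with [x], while [Ck_on]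
    differentiates in constant directions. *)
Lemma derive_comp_coord V W p (f : V -> 'rV[R]_p.+1) (g : 'rV[R]_p.+1 -> W) x v :
  differentiable f x -> differentiable g (f x) ->
  'D_v (g \o f) x = \sum_i 'D_v f x 0 i *: 'D_(delta_mx 0 i) g (f x).
Proof.
move=> df dg; rewrite deriveE; last exact: differentiable_comp.
rewrite diff_comp//= -(deriveE _ df) [in LHS](row_sum_delta ('D_v f x)) linear_sum.
by apply: eq_bigr => i _; rewrite linearZ /= (deriveE _ dg).
Qed.

Lemma Ck_on_comp V p k (U : set V) (U' : set 'rV[R]_p.+1) (f : V -> 'rV[R]_p.+1)
    (g : 'rV[R]_p.+1 -> R^o) :
  open U -> (forall x, U x -> U' (f x)) ->
  Ck_on k U f -> Ck_on k U' g -> Ck_on k U (g \o f).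
Proof.
move=> oU UU'; elim: k g => [|k IH] g.
  move=> cf cg x Ux; exact: (continuous_comp (cf x Ux) (cg _ (UU' x Ux))).
move=> Cf; have Cf' := Ck_on_lower Cf; case: Cf => [df Df] [dg Dg].
split=> [x Ux|v].
  exact: (differentiable_comp (df x Ux) (dg _ (UU' x Ux))).
apply: (@Ck_on_eq _ _ _ _ (fun x => \sum_i 'D_v f x 0 i * 'D_(delta_mx 0 i) g (f x))) => //.
  by move=> x Ux; rewrite derive_comp_coord//; [exact: df|exact/dg/UU'].
apply: Ck_on_sum => // i; apply: Ck_on_mul => //; first exact: Ck_on_coord (Df v).
exact: IH (Dg _).
Qed.

Lemma Ck_on_bilinear_form V p k (U : set V)
    (G : V -> 'M[R]_p.+1) (u v : V -> 'rV[R]_p.+1) : open U ->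
  (forall i j, Ck_on k U (fun x => G x i j : R^o)) -> Ck_on k U u -> Ck_on k U v ->
  Ck_on k U (fun x => bilinear_form (G x) (u x) (v x) : R^o).
Proof.
move=> oU CG Cu Cv.
apply: (@Ck_on_eq _ _ _ _ (fun x => \sum_j (\sum_i u x 0 i * G x i j) * v x 0 j : R^o)) => //.
  by move=> x _; rewrite /bilinear_form mxE; apply: eq_bigr => j _; rewrite !mxE.
apply: Ck_on_sum => // j; apply: Ck_on_mul => //; last exact: Ck_on_coord.
by apply: Ck_on_sum => // i; apply: Ck_on_mul => //; exact: Ck_on_coord.
Qed.

End Ck_calculus.

(** * Paths and isomorphisms of path semicategories *)

Section unit_interval.
Context {R : realType}.

(** [S] collects the [t] such that [h] stays above [h a] on all of [[a, t]]. From a point of [S]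
    close to the supremum, local monotonicity carries the bound beyond the supremum, unless the
    latter is [b]. *)
Lemma locally_nondecreasing (h : R -> R) (a b : R) :
  (forall t0, t0 \in `[a, b] -> exists2 d, 0 < d &
    forall s t, s \in `]t0 - d, t0 + d[ -> s \in `[a, b] ->
      t \in `]t0 - d, t0 + d[ -> t \in `[a, b] -> s < t -> h s <= h t) ->
  a <= b -> h a <= h b.
Proof.
move=> loc ab; pose S := [set t | t \in `[a, b] /\ forall r, r \in `[a, t] -> h a <= h r].
have Sa : S a.
  split; first by rewrite in_itv /= lexx.
  move=> r; rewrite in_itv /= => /andP[ar ra].
  by rewrite (@le_anti _ _ r a) ?ar ?ra.
have hS : has_sup S.
  by split; [exists a|exists b => t [+ _]; rewrite in_itv /= => /andP[]].
have asup : a <= sup S by exact: sup_upper_bound.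
have supb : sup S <= b.
  by apply: ge_sup => [|t [+ _]]; [exists a|rewrite in_itv /= => /andP[]].
have [|d d0 dP] := loc (sup S); first by rewrite in_itv /= asup.
have [t [tab tS] td] := sup_adherent d0 hS.
have tsup : t <= sup S by apply: sup_upper_bound.
pose u := Num.min b (sup S + d / 2).
have ub : u <= b by rewrite ge_min lexx.
have ud : u <= sup S + d / 2 by rewrite ge_min lexx orbT.
have uS : sup S <= u by rewrite le_min supb /=; lra.
have au : a <= u by exact: le_trans uS.
move: tab; rewrite in_itv /= => /andP[at_ tb].
have Su : S u.
  split; first by rewrite in_itv /= au.
  move=> r; rewrite in_itv /= => /andP[ar ru].
  have [rt|tr] := leP r t; first by apply: tS; rewrite in_itv /= ar.
  apply: (@le_trans _ _ (h t)); first by apply: tS; rewrite in_itv /= at_ lexx.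
  by apply: dP => //; rewrite in_itv /=; apply/andP; split; lra.
have us : u <= sup S by exact: sup_upper_bound.
have bu : b <= u by rewrite le_min lexx /=; move: us; rewrite /u /Num.min; case: ifP; lra.
by case: Su => _; apply; rewrite in_itv /= ab.
Qed.

(** A continuity method in [s]: the parameters whose path lies in [O] form an open set by
    compactness of [[0, 1]], and a closed one because such paths even lie in the closed set [C]. *)
Lemma homotopy_confined (X : topologicalType) (H : R * R -> X) (O C : set X) :
  {within `[0, 1]%classic `*` `[0, 1]%classic, continuous H} ->
  open O -> closed C -> C `<=` O ->
  (forall s, s \in `[0, 1] -> (forall t, t \in `[0, 1] -> O (H (s, t))) ->
     forall t, t \in `[0, 1] -> C (H (s, t))) ->
  (forall t, t \in `[0, 1] -> O (H (0, t))) ->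
  forall s t, s \in `[0, 1] -> t \in `[0, 1] -> C (H (s, t)).
Proof.
move=> /subspace_continuousP cH oO cC CO OC O0.
pose E := [set s : R | s \in `[0, 1] -> forall t, t \in `[0, 1] -> O (H (s, t))].
have EE s : s \in `[0, 1] -> E s -> E° s.
  move=> s01 Es; have K := (compact_near_coveringP _).1 (@segment_compact R 0 1).
  rewrite /interior /= /nbhs /=.
  apply: filterS (K R (nbhs s)
    (fun s' t => s' \in `[0, 1] -> t \in `[0, 1] -> O (H (s', t))) _ _).
    move=> s' Ks' s'01 t t01; exact: (Ks' t t01 s'01 t01).
  move=> t t01.
  have [[/= A B] [/= As Bt] AB] :=
    cH (s, t) (conj s01 t01) O (open_nbhs_nbhs (conj oO (Es s01 t t01))).
  by exists (B, A) => //= -[t' s'] /= [Bt' As'] s'01 t'01; exact: (AB (s', t')).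
have E01 : `[0, 1]%classic `&` E = `[0, 1]%classic.
  apply: (@segment_connected R 0 1).
  - by exists 0; split; [rewrite /= in_itv /= lexx ler01|move=> _; exact: O0].
  - exists E°; first exact: open_interior.
    by apply/seteqP; split=> s [s01]; [move=> /(EE s s01)|move=> /interior_subset].
  - exists (`[0, 1]%classic `&` E); last by rewrite setIA setIid.
    move=> s cls; have s01 : s \in `[0, 1].
      have cI : closed (`[0, 1]%classic : set R) by exact: itv_closed.
      exact: cI (closureI cls).1.
    split=> // _ t t01; apply: CO; apply: contrapT => nC.
    have := cH (s, t) (conj s01 t01) (~` C) _.
    move=> [|[/= A B] [/= As Bt] AB].
      by apply: open_nbhs_nbhs; split=> //; exact: closed_openC.
    have [s' [[s'01 Es'] As']] := cls _ As.
    apply: (AB (s', t)) => //=; first by split=> //; exact: nbhs_singleton.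
    exact: OC (Es' s'01) _ t01.
move=> s t s01 t01; apply: OC => //.
have [_ /(_ s01)] : (`[0, 1]%classic `&` E) s by rewrite E01.
exact.
Qed.

End unit_interval.

Section path_decomposition.
Context {R : realType} {X : topologicalType}.
Implicit Types (L : local_order X) (x y : X) (c : R -> X).

Lemma is_path_restrict L x y c (a b : R) : is_path L x y c ->
  0 <= a -> a < b -> b <= 1 ->
  is_path L (c a) (c b) (fun t => c (a + (b - a) * t)).
Proof.
move=> [cc oc c0 c1] a0 ab b1.
have q0 : a + (b - a) * 0 = a by rewrite mulr0 addr0.
have q1 : a + (b - a) * 1 = b by rewrite mulr1; ring.
have qI t : t \in `[0, 1] -> a + (b - a) * t \in `[0, 1].
  by rewrite !in_itv /= => /andP[t0 t1]; apply/andP; split; nra.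
split; rewrite ?q0 ?q1//.
  apply: (within_comp (g := fun t : R => a + (b - a) * t)) cc => //.
  move=> t; apply: cvgD; first exact: cvg_cst.
  by apply: cvgM; [exact: cvg_cst|exact: cvg_id].
move=> t0 t0I U oU Ut0; have [d d0 dP] := oc _ (qI _ t0I) U oU Ut0.
exists d => // s t; rewrite !in_itv /= => /andP[s1 s2] /andP[s3 s4].
move=> /andP[t1 t2] /andP[t3 t4] st.
apply: dP; rewrite ?qI// ?in_itv /= ?s3 ?t3// ?ltrD2l ?ltr_pM2l ?subr_gt0//;
  by apply/andP; split; nra.
Qed.

(** The concatenation is [c] composed with the piecewise linear map [p], which is strictly
    increasing, as it must be when [L] is not reflexive. The unsimplified first half is the instance
    [a = 0] of [is_path_restrict]. *)
Lemma is_path_split L x y c (r : R) : is_path L x y c -> 0 < r -> r < 1 ->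
  path_homotopy L x y
    (concat (fun t => c (0 + (r - 0) * t)) (fun t => c (r + (1 - r) * t))) c.
Proof.
move=> pc r0 r1.
pose p (t : R) := if t <= 2^-1 then 2 * r * t else r + (1 - r) * (2 * t - 1).
have pr : reparametrization L p.
  split.
  - have c1 : continuous (fun t : R => 2 * r * t).
      by move=> t; apply: cvgM; [exact: cvg_cst|exact: cvg_id].
    have c2 : continuous (fun t : R => r + (1 - r) * (2 * t - 1)).
      move=> t; apply: cvgD; first exact: cvg_cst.
      apply: cvgM; first exact: cvg_cst.
      apply: cvgB; last exact: cvg_cst.
      by apply: cvgM; [exact: cvg_cst|exact: cvg_id].
    (* The slope of [p] changes from [2 r] to [2 (1 - r)]: [p] is the maximum of its two affine
       pieces if it is convex and their minimum if it is concave. *)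
    have [rh|rh] := leP r 2^-1.
      rewrite (_ : p = (fun t : R => 2 * r * t) \max (fun t : R => r + (1 - r) * (2 * t - 1))).
        exact: max_fun_continuous.
      apply/funext => t; rewrite /p /=.
      have [th|th] := leP t 2^-1; last by apply/esym/max_idPr; nra.
      by apply/esym/max_idPl; nra.
    rewrite (_ : p = (fun t : R => 2 * r * t) \min (fun t : R => r + (1 - r) * (2 * t - 1))).
      exact: min_fun_continuous.
    apply/funext => t; rewrite /p /=.
    have [th|th] := leP t 2^-1; last by apply/esym/min_idPr; nra.
    by apply/esym/min_idPl; nra.
  - by rewrite /p ifT ?mulr0// invr_ge0.
  - by rewrite /p ifF; [ring|apply/negbTE; rewrite -ltNge; lra].
  - move=> s t st; left; rewrite /p.
    by have [sh|sh] := leP s 2^-1; have [th|th] := leP t 2^-1; nra.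
have := path_homotopy_reparametrize pr pc.
congr path_homotopy; apply/funext => t /=; rewrite /concat /p.
by case: ifP => _; congr c; ring.
Qed.

End path_decomposition.

Section isomorphic_path_semicategories.

(** [K] is a variable so that the equation can be eliminated; for the composite of [F] and [G] the
    objects [G (F x)] and [x] are only propositionally equal, and [h] and [k] would have to be
    transported. *)
Lemma semifunctor_id_factor (C : semicategory) (K : semifunctor C C) :
  K = semifunctor_id C -> forall (x y : C) (a : Defs.hom x y) (u : C)
    (h : Defs.hom u (K y)) (k : Defs.hom (K x) u), fhom K a = Defs.comp h k ->
  exists (h' : Defs.hom u y) (k' : Defs.hom x u), a = Defs.comp h' k'.
Proof. by move=> -> x y a u h k /= ->; exists h, k. Qed.

Context {R : realType} {X Y : topologicalType}.
Variables (LX : local_order X) (LY : local_order Y).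
Variables (F : semifunctor (@path_semicategory R X LX) (@path_semicategory R Y LY)).
Variables (G : semifunctor (@path_semicategory R Y LY) (@path_semicategory R X LX)).
Hypothesis GF : semifunctor_comp G F = semifunctor_id _.

(* An interior point z of a path representing F [c] factors F [c], so [c] factors
   through G z, i.e. G z lies on some path homotopic to c. *)
Lemma iso_path (W : set X) (x y : X) (c : R -> X) : is_path LX x y c ->
  (forall c', path_homotopy LX x y c c' ->
     forall t : R, t \in `[0, 1] -> W (c' t)) ->
  exists2 d : R -> Y, is_path LY (F x) (F y) d &
    forall t : R, t \in `[0, 1] -> W (G (d t)).
Proof.
move=> pc Wc.
have GFE z : G (F z) = z by exact: (congr1 (fun K : semifunctor _ _ => K z) GF).
have Wc0 := Wc c (path_homotopy_refl pc).
pose a : @Defs.hom (@path_semicategory R X LX) x y := \pi_(path_class LX x y) (Lpath pc).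
pose d := repr (fhom F a : path_class LY (F x) (F y)).
have dE : \pi_(path_class LY (F x) (F y)) d = fhom F a by exact: reprK.
have pd := lpathP d.
(* The end points are treated apart, since cutting there would leave a degenerate piece, which need
   not be a morphism of a semicategory. [G] sends them to the end points of [c]. *)
exists d => // t; rewrite in_itv /= le_eqVlt => /andP[/predU1P[<- _|t0]].
  case: pd => _ _ -> _; rewrite GFE; case: (pc) => _ _ <- _.
  by apply: Wc0; rewrite in_itv /= lexx ler01.
rewrite le_eqVlt => /predU1P[->|t1].
  case: pd => _ _ _ ->; rewrite GFE; case: (pc) => _ _ _ <-.
  by apply: Wc0; rewrite in_itv /= lexx ler01.
have pd1 := is_path_restrict pd (lexx 0) t0 (ltW t1).
have pd2 := is_path_restrict pd (ltW t0) t1 (lexx 1).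
have d0 : d 0 = F x by case: pd.
have d1 : d 1 = F y by case: pd.
move: pd1 pd2; rewrite d0 d1 => pd1 pd2.
have aE : fhom F a = @Defs.comp (@path_semicategory R Y LY) _ _ _
    (\pi_(path_class LY (d t) (F y)) (Lpath pd2))
    (\pi_(path_class LY (F x) (d t)) (Lpath pd1)).
  rewrite -dE /= class_comp_pi; apply/esym/path_class_eqP.
  exact: is_path_split.
have := @semifunctor_id_factor _ _ GF x y a (G (d t))
  (fhom G (\pi_(path_class LY (d t) (F y)) (Lpath pd2)))
  (fhom G (\pi_(path_class LY (F x) (d t)) (Lpath pd1))).
case=> [|h [k]]; first by rewrite /= aE fhomM.
rewrite /= -[h]reprK -[k]reprK class_comp_pi => /path_class_eqP /Wc Wk.
(* At time [2^-1] the concatenation passes through the intermediate object [G (d t)]. *)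
have := Wk 2^-1; rewrite /= /concat lexx.
have -> : 2 * 2^-1 = 1 :> R by lra.
by case: (lpathP (repr k)) => _ _ _ ->; apply; rewrite in_itv /=; apply/andP; split; lra.
Qed.

End isomorphic_path_semicategories.

(** * Local causality *)

Section matrix_limits.
Context {R : realType}.

Lemma cvg_coord (T : Type) (F : set_system T) p q (f : T -> 'M[R]_(p.+1, q.+1)) (l : 'M[R]_(p.+1, q.+1)) i j :
  Filter F -> f t @[t --> F] --> l -> f t i j @[t --> F] --> l i j.
Proof.
move=> FF fl; exact: (cvg_comp _ _ fl (@coord_continuous R _ _ i j l)).
Qed.

Lemma cvg_pairing (T : Type) (F : set_system T) n (f : T -> 'rV[R]_n.+1) (l : 'rV[R]_n.+1) (a : 'cV[R]_n.+1) :
  Filter F -> f t @[t --> F] --> l -> (f t *m a) 0 0 @[t --> F] --> (l *m a) 0 0.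
Proof.
move=> FF fl; rewrite mxE; under eq_fun do rewrite mxE.
apply: cvg_big => [|i _]; first exact: add_continuous.
by apply: cvgM; [exact: cvg_coord|exact: cvg_cst].
Qed.

Lemma cvg_bilinear_form (T : Type) (F : set_system T) n (G : T -> 'M[R]_n.+1)
    (u v : T -> 'rV[R]_n.+1) (G0 : 'M[R]_n.+1) (u0 v0 : 'rV[R]_n.+1) : Filter F ->
  G t @[t --> F] --> G0 -> u t @[t --> F] --> u0 -> v t @[t --> F] --> v0 ->
  bilinear_form (G t) (u t) (v t) @[t --> F] --> bilinear_form G0 u0 v0.
Proof.
move=> FF GG uu vv.
have E (H : 'M[R]_n.+1) (x y : 'rV[R]_n.+1) :
    bilinear_form H x y = \sum_j (\sum_i x 0 i * H i j) * y 0 j.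
  by rewrite /bilinear_form mxE; apply: eq_bigr => j _; rewrite !mxE.
rewrite E; under eq_fun do rewrite E.
apply: cvg_big => [|j _]; first exact: add_continuous.
apply: cvgM; last exact: cvg_coord.
apply: cvg_big => [|i _]; first exact: add_continuous.
by apply: cvgM; exact: cvg_coord.
Qed.

Lemma coord_le_norm n (v : 'rV[R]_n.+1) i : `|v 0 i| <= `|v|.
Proof. by rewrite [leRHS]/Num.Def.normr /= mx_normrE; apply/bigmax_geP; right; exists (0, i). Qed.

Lemma norm_le_coord n (v : 'rV[R]_n.+1) e : 0 <= e -> (forall i, `|v 0 i| <= e) -> `|v| <= e.
Proof.
by move=> e0 ve; rewrite [leLHS]/Num.Def.normr /= mx_normrE bigmax_le// => -[i j] _ /=; rewrite ord1.
Qed.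

Lemma has_velocity_pairing n (A : set R) (f : R -> 'rV[R]_n.+1) (t : R) v (a : 'cV[R]_n.+1) :
  nbhs t A -> has_velocity A f t v ->
  is_derive t (1 : R) (fun s => (f s *m a) 0 0 : R^o) ((v *m a) 0 0).
Proof.
move=> tA fv.
have fv0 : h^-1 *: (f (h *: 1 + t) - f t) @[h --> 0^'] --> v.
  move=> W /((has_velocityP _ _ _ _).1 fv) Wt.
  have /nbhs0P : \forall s \near t, s != t -> W ((s - t)^-1 *: (f s - f t)).
    by apply: filterS2 tA Wt => s As Ws st; exact: Ws.
  rewrite /nbhs /= /within /=; apply: filterS => h hW h0.
  have := hW; rewrite addrAC subrr add0r -subr_eq0 addrAC subrr add0r => /(_ h0).
  by rewrite /GRing.scale /= mulr1 (addrC h).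
have fa : h^-1 *: ((f (h *: 1 + t) *m a) 0 0 - (f t *m a) 0 0 : R^o) @[h --> 0^'] --> (v *m a) 0 0.
  have := cvg_pairing (a := a) _ fv0; under eq_fun do rewrite -scalemxAl mulmxBl !mxE.
  by under [in X in _ -> X]eq_fun do rewrite !mxE; exact.
by apply: DeriveDef; [apply/cvg_ex; eexists; exact: fa|exact: cvg_lim fa].
Qed.

End matrix_limits.

Lemma within_continuousW (T S : topologicalType) (A : set T) (f : T -> S) :
  (forall x, A x -> f y @[y --> x] --> f x) -> {within A, continuous f}.
Proof.
move=> cf; apply/subspace_continuousP => x Ax.
by apply: cvg_within_filter; exact: cf.
Qed.

Section charts.
Context {R : realType} {n : nat} {X : topologicalType} (c : chart R n X).

Lemma chart_dom_nbhs x : chart_dom c x -> nbhs x (chart_dom c).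
Proof. by move=> cx; apply: open_nbhs_nbhs; split=> //; exact: chart_dom_open. Qed.

Lemma chart_cod_nbhs u : chart_cod c u -> nbhs u (chart_cod c).
Proof. by move=> cu; apply: open_nbhs_nbhs; split=> //; exact: chart_cod_open. Qed.

Lemma chart_cvg x : chart_dom c x -> c y @[y --> x] --> c x.
Proof.
move=> cx; have := @chart_fun_cont _ _ _ c.
by rewrite (continuous_open_subspace _ (@chart_dom_open _ _ _ c)) => /(_ x); apply; rewrite inE.
Qed.

Lemma chart_inv_cvg u : chart_cod c u -> chart_inv c v @[v --> u] --> chart_inv c u.
Proof.
move=> cu; have := @chart_inv_cont _ _ _ c.
by rewrite (continuous_open_subspace _ (@chart_cod_open _ _ _ c)) => /(_ u); apply; rewrite inE.
Qed.

End charts.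

Section local_causality.
Context {R : realType} {n : nat} (X : spacetime R n).
Implicit Types (c d : chart R n X) (x y p : X) (u v w : 'rV[R]_n.+1) (a : 'cV[R]_n.+1).

Lemma metric_cvg c x : atlas c -> chart_dom c x -> metric c y @[y --> x] --> metric c x.
Proof.
move=> Ac cx.
have mc0 : Ck_on 0 (chart_cod c) (metric c \o chart_inv c) by exact: metric_smooth Ac 0.
have := mc0 _ (chart_fun_cod cx).
rewrite /prop_for /continuous_at /= (chart_funK cx) => mc.
have : metric c (chart_inv c (c y)) @[y --> x] --> metric c x.
  exact: (cvg_comp _ _ (chart_cvg cx) mc).
apply: cvg_trans; apply: near_eq_cvg.
by apply: filterS (chart_dom_nbhs cx) => y cy; rewrite chart_funK.
Qed.

Lemma time_field_cvg c x : atlas c -> chart_dom c x ->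
  time_field c y @[y --> x] --> time_field c x.
Proof.
move=> Ac cx; have := time_field_cont Ac.
by rewrite (continuous_open_subspace _ (@chart_dom_open _ _ _ c)) => /(_ x); apply; rewrite inE.
Qed.

Lemma metric_symmetric c x : atlas c -> chart_dom c x -> (metric c x)^T = metric c x.
Proof. by move=> Ac cx; have [] := metric_lorentzian Ac cx. Qed.

Lemma bilinear_form_change c d x u v :
  atlas c -> atlas d -> chart_dom c x -> chart_dom d x ->
  bilinear_form (metric c x) u v = bilinear_form (metric d x)
    (u *m local_jacobian c d id x) (v *m local_jacobian c d id x).
Proof.
by move=> Ac Ad cx dx; rewrite (metric_change Ac Ad cx dx) bilinear_form_congr.
Qed.

Lemma future_timelike_change c d x v :
  atlas c -> atlas d -> chart_dom c x -> chart_dom d x ->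
  future_timelike c x v -> future_timelike d x (v *m local_jacobian c d id x).
Proof.
move=> Ac Ad cx dx [vv vT]; split; first by rewrite -bilinear_form_change.
by rewrite (time_field_change Ac Ad cx dx) -bilinear_form_change.
Qed.

Lemma future_timelike_near c x v : atlas c -> chart_dom c x ->
  future_timelike c x v -> \forall y \near x, future_timelike c y v.
Proof.
move=> Ac cx [vv vT].
have B (f : X -> 'rV[R]_n.+1) : f y @[y --> x] --> f x ->
    bilinear_form (metric c x) v (f x) < 0 ->
    \forall y \near x, bilinear_form (metric c y) v (f y) < 0.
  move=> cf; apply: (cvgr_lt _ _) => //.
  by apply: cvg_bilinear_form => //; [exact: metric_cvg|exact: cvg_cst].
apply: filterS2 (B (fun=> v) _ vv) (B _ (time_field_cvg Ac cx) vT) => //.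
exact: cvg_cst.
Qed.

(* The set of causal directions is compact, so a functional that is positive on
   it is uniformly positive on the causal directions at nearby points. *)
Lemma causal_pairing_ge c x a : atlas c -> chart_dom c x ->
  (forall v, v != 0 -> bilinear_form (metric c x) v v <= 0 ->
     bilinear_form (metric c x) v (time_field c x) <= 0 -> 0 < (v *m a) 0 0) ->
  exists2 e : R, 0 < e & \forall y \near x, forall v, future_causal c y v ->
    e * `|v| <= (v *m a) 0 0.
Proof.
move=> Ac cx a0.
pose S := [set v : 'rV[R]_n.+1 | `|v| = 1].
have cS : compact S.
  apply: bounded_closed_compact.
    by exists 1; split=> // M M1 v /= ->; exact: ltW.
  rewrite (_ : S = (fun v : 'rV[R]_n.+1 => `|v|) @^-1` [set 1])//.
  by apply: closed_comp => [v _|]; [exact: norm_continuous|exact: closed_eq].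
(* The second component of [i] is the bound sought. It tends to [0] from the right while the base
   point tends to [x], so one compactness argument yields both a common neighbourhood and a common
   bound. *)
pose P (i : X * R) v := bilinear_form (metric c i.1) v v <= 0 ->
  bilinear_form (metric c i.1) v (time_field c i.1) <= 0 -> i.2 <= (v *m a) 0 0.
have := (compact_near_coveringP S).1 cS (X * R)%type
  (filter_prod (nbhs x) (0 : R)^'+) P _.
case=> [v /= v1|/= [A B] [/= Ax B0] AB].
  have gv : bilinear_form (metric c z.2.1) z.1 z.1
      @[z --> filter_prod (nbhs v) (filter_prod (nbhs x) (0 : R)^'+)] -->
      bilinear_form (metric c x) v v.
    apply: cvg_bilinear_form; try exact: cvg_fst.
    apply: cvg_comp (metric_cvg Ac cx).
    by apply: cvg_comp cvg_snd _; exact: cvg_fst.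
  have gT : bilinear_form (metric c z.2.1) z.1 (time_field c z.2.1)
      @[z --> filter_prod (nbhs v) (filter_prod (nbhs x) (0 : R)^'+)] -->
      bilinear_form (metric c x) v (time_field c x).
    apply: cvg_bilinear_form.
    - apply: cvg_comp (metric_cvg Ac cx).
      by apply: cvg_comp cvg_snd _; exact: cvg_fst.
    - exact: cvg_fst.
    - apply: cvg_comp (time_field_cvg Ac cx).
      by apply: cvg_comp cvg_snd _; exact: cvg_fst.
  suff : \forall z \near filter_prod (nbhs v) (filter_prod (nbhs x) (0 : R)^'+), P z.2 z.1.
    by [].
  (* By [a0] a unit vector without positive pairing is spacelike or pairs positively with the time
     field. Both are open conditions, under which [P] holds vacuously. *)
  have [va|va] := pselect (0 < (v *m a) 0 0).
    have za : (z.1 *m a) 0 0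
        @[z --> filter_prod (nbhs v) (filter_prod (nbhs x) (0 : R)^'+)] --> (v *m a) 0 0.
      by apply: cvg_pairing; exact: cvg_fst.
    have ze : z.2.2 @[z --> filter_prod (nbhs v) (filter_prod (nbhs x) (0 : R)^'+)] --> (0 : R)^'+.
      by apply: cvg_comp cvg_snd _; exact: cvg_snd.
    have va2 : 0 < (v *m a) 0 0 / 2 by rewrite divr_gt0.
    have h1 : \forall z \near filter_prod (nbhs v) (filter_prod (nbhs x) (0 : R)^'+),
        z.2.2 < (v *m a) 0 0 / 2 := ze _ (nbhs_right_lt va2).
    have h2 : \forall z \near filter_prod (nbhs v) (filter_prod (nbhs x) (0 : R)^'+),
        (v *m a) 0 0 / 2 < (z.1 *m a) 0 0.
      by apply: (cvgr_gt _ za); lra.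
    by near=> z => _ _; apply: ltW; apply: (@lt_trans _ _ ((v *m a) 0 0 / 2)); near: z.
  have v0 : v != 0 by rewrite -normr_eq0 v1 oner_eq0.
  have [gv0|gv0] := leP (bilinear_form (metric c x) v v) 0.
    have gT0 : 0 < bilinear_form (metric c x) v (time_field c x).
      by rewrite ltNge; apply/negP => gT0; exact: va (a0 v v0 gv0 gT0).
    by apply: filterS (cvgr_gt _ gT _ gT0) => z /= zT _ zv; have := lt_le_trans zT zv; rewrite ltxx.
  by apply: filterS (cvgr_gt _ gv _ gv0) => z /= zT zv; have := lt_le_trans zT zv; rewrite ltxx.
have [e [e0 Be]] : exists e, 0 < e /\ B e.
  have [e [? ?]] := @filter_ex _ _ _ _ (filterI (nbhs_right_gt (0 : R)) B0).
  by exists e.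
exists e => //; apply: filterS Ax => y Ay v [v0 vv vT].
have nv0 : 0 < `|v| by rewrite normr_gt0.
have Su : S (`|v|^-1 *: v).
  by rewrite /S /= normrZ ger0_norm ?invr_ge0// mulVf// gt_eqF.
have := AB (y, e) (conj Ay Be) _ Su; rewrite /P /= !bilinear_formE -scalemxAl mxE.
rewrite ler_pdivlMl// (mulrC _ e); apply.
  by rewrite !pmulr_rle0 ?invr_gt0.
by rewrite pmulr_rle0 ?invr_gt0// ltW.
Unshelve. all: by end_near.
Qed.

Lemma causally_before_pairing c (N : set X) a : atlas c -> N `<=` chart_dom c ->
  (forall y, N y -> forall v, future_causal c y v -> 0 <= (v *m a) 0 0) ->
  forall x y, causally_before N x y -> (c x *m a) 0 0 <= (c y *m a) 0 0.
Proof.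
move=> Ac Nc Na x y [[_ ->]//|[g [t0 [s [_ gs <- <-]]]]].
elim: s t0 gs => [//|b s IH] t0 /= [[t0b cg Ng vg] /IH]; apply: le_trans.
have [v cv vP] := vg c Ac.
pose f t := (c (g t) *m a) 0 0.
have df t : t \in `]t0, b[ -> is_derive t (1 : R) (f : R -> R^o) ((v t *m a) 0 0).
  move=> tI; have tI' : t \in `[t0, b] by exact: subset_itv_oo_cc.
  apply: (@has_velocity_pairing _ _ `[t0, b]%classic (c \o g)).
    apply: filterS (near_in_itvoo tI) => r; exact: subset_itv_oo_cc.
  exact: (vP t tI' (Nc _ (Ng t tI'))).1.
apply: (@ger0_derive1_le_cc R f t0 b) => //; rewrite ?in_itv /= ?lexx ?(ltW t0b)//.
- by move=> t /df [].
- move=> t tI; have [_ fE] := df t tI; rewrite derive1E fE.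
  have tI' : t \in `[t0, b] by exact: subset_itv_oo_cc.
  exact: Na (Ng t tI') _ (vP t tI' (Nc _ (Ng t tI'))).2.
- apply/subspace_continuousP => t tI; apply: cvg_pairing.
  move/subspace_continuousP: cg => /(_ t tI) cg.
  exact: (cvg_comp _ _ cg (chart_cvg (Nc _ (Ng t tI)))).
Qed.

(** Continuous causal paths need not be differentiable. With [N] itself as the neighbourhood in
    their definition, nearby points are related by [causally_before N], so the functional is locally
    nondecreasing. *)
Lemma causal_path_pairing c (N : set X) a x y (g : R -> X) : atlas c -> open N ->
  N `<=` chart_dom c ->
  (forall y, N y -> forall v, future_causal c y v -> 0 <= (v *m a) 0 0) ->
  is_path (causal_order X) x y g -> (forall t, t \in `[0, 1] -> N (g t)) ->
  forall s t : R, 0 <= s -> s <= t -> t <= 1 -> (c (g s) *m a) 0 0 <= (c (g t) *m a) 0 0.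
Proof.
move=> Ac oN Nc Na [_ og _ _] Ng s t s0 st t1.
have I r : r \in `[s, t] -> r \in `[0, 1].
  by rewrite !in_itv /= => /andP[sr rt]; rewrite (le_trans s0)// (le_trans rt).
apply: (@locally_nondecreasing R (fun r => (c (g r) *m a) 0 0)) => // t0 /I t0I.
have [e e0 eP] := og t0 t0I N oN (Ng t0 t0I).
exists e => // r1 r2 ? /I ? ? /I ? r12.
by apply: (causally_before_pairing Ac Nc Na); exact: eP.
Qed.

Lemma line_cvg u v (t0 : R) : u + t *: v @[t --> t0] --> u + t0 *: v.
Proof. by apply: cvgD; [exact: cvg_cst|exact: scalel_continuous]. Qed.

Lemma timelike_future c x v : atlas c -> chart_dom c x ->
  bilinear_form (metric c x) v v < 0 ->
  future_timelike c x v \/ future_timelike c x (- v).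
Proof.
move=> Ac cx vv; rewrite /future_timelike -scaleN1r !bilinear_formE.
have [vT|vT|vT] := ltgtP (bilinear_form (metric c x) v (time_field c x)) 0.
- by left.
- by right; split; lra.
have := timelike_orthogonal (metric_lorentzian Ac cx) (time_field_timelike Ac cx) vT (ltW vv).
by move=> v0; move: vv; rewrite v0 /bilinear_form !mul0mx mxE ltxx.
Qed.

(** The velocity is constant in the chart [c] only. In another chart it is the derivative of the
    coordinate change in direction [v], and the Jacobian carries the cone condition over. *)
Lemma straight_C1_segment c (U : set X) u v (a b : R) : atlas c -> a < b ->
  (forall t, t \in `[a, b] -> [/\ chart_cod c (u + t *: v),
     U (chart_inv c (u + t *: v)) & future_timelike c (chart_inv c (u + t *: v)) v]) ->
  C1_segment (@future_timelike R n X) U (fun t => chart_inv c (u + t *: v)) a b.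
Proof.
move=> Ac ab inU; split=> //.
- apply: within_continuousW => t tI.
  have [ct _ _] := inU t tI.
  exact: (cvg_comp _ _ (@line_cvg u v t) (chart_inv_cvg ct)).
- by move=> t /inU[].
move=> d Ad; exists (fun t => 'D_v (local_expr c d id) (u + t *: v)).
  apply: within_continuousW => t [tI dt].
  have [ct _ _] := inU t tI.
  have sm : Ck_on 1 (local_dom c d id) (local_expr c d id) by exact: atlas_smooth.
  exact: (cvg_comp _ _ (@line_cvg u v t) (sm.2 v _ (conj ct dt))).
move=> t tI dt; have [ct _ vt] := inU t tI.
have sm : Ck_on 1 (local_dom c d id) (local_expr c d id) by exact: atlas_smooth.
have df := sm.1 _ (conj ct dt); split.
  apply/has_velocityP => W.
  have : cvg _ := @diff_derivable _ _ _ _ _ v df.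
  move=> cf vW; have cW : \forall h \near (0 : R), h != 0 -> W (h^-1 *:
      (local_expr c d id (h *: v + (u + t *: v)) - local_expr c d id (u + t *: v))).
    exact: cf vW.
  suff : \forall s \near t, s != t -> s \in `[a, b] -> W ((s - t)^-1 *:
      (local_expr c d id (u + s *: v) - local_expr c d id (u + t *: v))) by [].
  apply/nbhs0P; apply: filterS cW => h hW ht _.
  have hE : t + h - t = h by rewrite addrAC subrr add0r.
  rewrite hE; have h0 : h != 0 by rewrite -hE subr_eq0.
  have := hW h0; rewrite /local_expr /= (_ : h *: v + (u + t *: v) = u + (t + h) *: v)//.
  by rewrite scalerDl addrCA (addrC (h *: v)).
rewrite deriveEjacobian//.
have -> : jacobian (local_expr c d id) (u + t *: v) =
    local_jacobian c d id (chart_inv c (u + t *: v)).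
  by rewrite /local_jacobian chart_invK.
by apply: future_timelike_change => //; exact: chart_inv_dom.
Qed.

Lemma straight_path c p v (U : set X) : atlas c -> chart_dom c p ->
  future_timelike c p v -> nbhs p U ->
  exists2 e : R, 0 < e & forall r : R, 0 < r < e ->
    is_path (chronological_order X) p (chart_inv c (c p + r *: v))
      (fun t => chart_inv c (c p + t *: (r *: v))) /\
    forall t : R, t \in `[0, 1] -> U (chart_inv c (c p + t *: (r *: v))).
Proof.
move=> Ac cp vp pU.
have l0 : c p + t *: v @[t --> (0 : R)] --> c p.
  by have := @line_cvg (c p) v 0; rewrite scale0r addr0.
have i0 : chart_inv c (c p + t *: v) @[t --> (0 : R)] --> p.
  rewrite -[X in _ --> X](chart_funK cp).
  exact: (cvg_comp _ _ l0 (chart_inv_cvg (chart_fun_cod cp))).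
have : \forall t \near (0 : R), [/\ chart_cod c (c p + t *: v),
     U (chart_inv c (c p + t *: v)) & future_timelike c (chart_inv c (c p + t *: v)) v].
  have n1 : \forall t \near (0 : R), chart_cod c (c p + t *: v).
    exact: l0 (chart_cod_nbhs (chart_fun_cod cp)).
  have n2 : \forall t \near (0 : R), U (chart_inv c (c p + t *: v)) by exact: i0.
  have n3 : \forall t \near (0 : R), future_timelike c (chart_inv c (c p + t *: v)) v.
    exact: i0 (future_timelike_near Ac cp vp).
  by near=> t; split; near: t.
move=> /nbhs_ballP[e /= e0 eP]; exists e => // r /andP[r0 re].
have Q t : t \in `[0, 1] -> [/\ chart_cod c (c p + t *: (r *: v)),
     U (chart_inv c (c p + t *: (r *: v))) &
     future_timelike c (chart_inv c (c p + t *: (r *: v))) (r *: v)].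
  rewrite in_itv /= => /andP[t0 t1]; rewrite scalerA.
  have [|? ? [vv vT]] := eP (t * r).
    rewrite /ball /= sub0r normrN ger0_norm; last by rewrite mulr_ge0// ltW.
    by apply: le_lt_trans re; rewrite ler_piMl// ltW.
  split=> //; split; rewrite !bilinear_formE; first by rewrite !pmulr_rlt0.
  by rewrite pmulr_rlt0.
have cg (t : R) : t \in `[0, 1] -> chart_inv c (c p + s *: (r *: v)) @[s --> t] --> chart_inv c (c p + t *: (r *: v)).
  move=> /Q[ct _ _].
  exact: (cvg_comp _ _ (@line_cvg (c p) (r *: v) t) (chart_inv_cvg ct)).
split; last by move=> t /Q[].
split.
- by apply: within_continuousW => t; exact: cg.
- move=> t0 t0I V oV Vt0.
  have := cg t0 t0I V (open_nbhs_nbhs (conj oV Vt0)).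
  move=> /nbhs_ballP[d /= d0 dP]; exists d => // s t.
  rewrite !in_itv /= => /andP[s1 s2] /andP[s3 s4] /andP[t1 t2] /andP[t3 t4] st.
  exists (fun t => chart_inv c (c p + t *: (r *: v))), s, [:: t]; split=> //=; split=> //.
  apply: straight_C1_segment => // q; rewrite in_itv /= => /andP[q1 q2].
  have [|cq _ vq] := Q q; first by rewrite in_itv /= (le_trans s3)// (le_trans q2).
  split=> //; apply: dP; rewrite /ball /= ltr_norml; apply/andP; split; lra.
- by rewrite scale0r addr0 chart_funK.
- by rewrite scale1r.
Unshelve. all: by end_near.
Qed.

Lemma curve_joins_causal (U : set X) x y :
  chron_before U x y -> causally_before U x y.
Proof.
move=> [g [a [s [s0 gs ga gl]]]]; right; exists g, a, s; split=> //.
elim: s a gs {s0 ga gl} => [//|b s IH] a /= [[ab cg Ug vg] /IH gs]; split=> //.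
split=> // c Ac; have [v cv vP] := vg c Ac; exists v => // t tI ct.
have [vt [vv vT]] := vP t tI ct; split=> //; split=> //; last exact: ltW.
by apply: contraTneq vv => ->; rewrite /bilinear_form mul0mx mul0mx mxE ltxx.
Qed.

(** The functional is minus the pairing with [w]. Taken for the time field it controls the size of
    small paths; taken for every [w] it tests a vector for causality by duality. *)
Lemma time_field_pairing c p v : atlas c -> chart_dom c p ->
  forall w, future_timelike c p w ->
  v != 0 -> bilinear_form (metric c p) v v <= 0 ->
  bilinear_form (metric c p) v (time_field c p) <= 0 ->
  0 < (v *m (- (metric c p *m w^T))) 0 0.
Proof.
move=> Ac cp w [ww wT] v0 vv vT.
have -> : (v *m (- (metric c p *m w^T))) 0 0 = - bilinear_form (metric c p) v w.
  by rewrite mulmxN mulmxA mxE.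
rewrite oppr_gt0.
apply: (causal_timelike_lt0 (metric_lorentzian Ac cp) ww (time_field_timelike Ac cp)) => //.
Qed.

(* Inside a small chart ball a causal path stays close to its end points,
   so the paths of a causal homotopy cannot leave the ball. *)
Lemma small_path_homotopy_confined p (W : set X) : nbhs p W ->
  exists2 U : set X, nbhs p U & forall x y g g',
    (forall t : R, t \in `[0, 1] -> U (g t)) ->
    path_homotopy (causal_order X) x y g g' ->
    forall t : R, t \in `[0, 1] -> W (g' t).
Proof.
move=> pW; have [c Ac cp] := atlas_cover p.
have TT : future_timelike c p (time_field c p).
  by split; exact: time_field_timelike.
pose a := - (metric c p *m (time_field c p)^T).
have [e e0 aN] := causal_pairing_ge (a := a) Ac cp
  (fun v => time_field_pairing Ac cp TT).
have : nbhs (c p) (fun u => chart_cod c u /\ (W (chart_inv c u) /\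
    forall v, future_causal c (chart_inv c u) v -> e * `|v| <= (v *m a) 0 0)).
  have ip : chart_inv c u @[u --> c p] --> p.
    by rewrite -[X in _ --> X](chart_funK cp); apply: chart_inv_cvg; exact: chart_fun_cod.
  apply: filterI; first exact: chart_cod_nbhs (chart_fun_cod cp).
  exact: ip (filterI pW aN).
move=> /nbhs_ballP[r /= r0 rP].
pose O := chart_dom c `&` c @^-1` (ball (c p) r).
have oO : open O.
  have /(continuous_inP _ (@chart_dom_open _ _ _ c)) : {in chart_dom c, continuous c}.
    by move=> x; rewrite inE; exact: chart_cvg.
  by apply; exact: ball_open.
have OP y : O y -> W y /\ forall v, future_causal c y v -> e * `|v| <= (v *m a) 0 0.
  by move=> [cy /rP[_]]; rewrite chart_funK.
pose B := [set u : 'rV[R]_n.+1 | `|c p - u| <= r / 2].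
have Br : B `<=` ball (c p) r.
  by move=> u; rewrite /B /= -ball_normE /ball_ /= => /le_lt_trans; apply; lra.
(* [C] is closed in all of [X], being compact in a Hausdorff space; closedness in the chart domain
   alone would allow limits outside it. *)
pose C := chart_inv c @` B.
have cC : closed C.
  apply: compact_closed; first exact: manifold_hausdorff.
  apply: continuous_compact.
    apply: continuous_subspaceW (@chart_inv_cont _ _ _ c) => u Bu.
    exact: (rP u (Br u Bu)).1.
  apply: bounded_closed_compact.
    exists (`|c p| + r); split=> [|M M1 u]; first exact: num_real.
    rewrite /B /= => Bu; apply: le_trans (ltW M1).
    rewrite -[u](subKr (c p)); apply: le_trans (ler_normB _ _) _.
    by rewrite lerD2l (le_trans Bu)//; lra.
  have cB : continuous (fun u : 'rV[R]_n.+1 => `|c p - u|).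
    by move=> u; exact: (cvg_norm (cvgB (cvg_cst _) cvg_id)).
  exact: (proj1 (continuous_closedP _) cB _ (@closed_le R (r / 2))).
have CO : C `<=` O.
  move=> _ [u Bu <-]; have cu := (rP u (Br u Bu)).1.
  by split; [exact: chart_inv_dom|rewrite /= chart_invK//; exact: Br].
(* A path in [O] moves each coordinate by at most the increase of [a] divided by [e], here at most
   twice [r / 8]. Added to the distance [r / 4] of [x] from [p], this gives the radius [r / 2] of
   [B]. *)
pose U := [set y | [/\ chart_dom c y, `|c p - c y| < r / 4 &
  `|(c p *m a) 0 0 - (c y *m a) 0 0| < e * (r / 8)]].
exists U.
  have n1 : \forall y \near p, `|c p - c y| < r / 4.
    by have /cvgrPdist_lt/(_ (r / 4)) := chart_cvg cp; apply; lra.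
  have n2 : \forall y \near p, `|(c p *m a) 0 0 - (c y *m a) 0 0| < e * (r / 8).
    have : (c y *m a) 0 0 @[y --> p] --> (c p *m a) 0 0.
      by apply: cvg_pairing; exact: chart_cvg.
    by move=> /cvgrPdist_lt/(_ (e * (r / 8))); apply; rewrite mulr_gt0//; lra.
  by apply: filterS3 (chart_dom_nbhs cp) n1 n2 => y; split.
move=> x y g g' Ug [H [cH H0 H1 HP]] t tI.
have I0 : (0 : R) \in `[0, 1] by rewrite in_itv /= lexx ler01.
have I1 : (1 : R) \in `[0, 1] by rewrite in_itv /= lexx ler01.
have x0 : g 0 = x by have [_ _ <- _] := HP 0 I0; rewrite H0.
have y1 : g 1 = y by have [_ _ _ <-] := HP 0 I0; rewrite H0.
have [cx x1 x2] : U x by rewrite -x0; exact: Ug.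
have [cy yy1 yy2] : U y by rewrite -y1; exact: Ug.
rewrite -H1//; apply: (OP _ (CO _ _)).1.
apply: (homotopy_confined cH oO cC CO) => // [s sI Os q qI|q qI]; last first.
  rewrite H0//; have [cq q1 _] := Ug q qI; split=> //=.
  by rewrite -ball_normE /ball_ /=; lra.
have [cq _] := Os q qI.
exists (c (H (s, q))); last by rewrite chart_funK.
have [_ _ Hs0 Hs1] := HP s sI.
have pair_delta u i : (u *m (delta_mx i 0 : 'cV[R]_n.+1)) 0 0 = u 0 i.
  by rewrite -colE mxE.
(* As a coordinate of [v] is at most [|v|], adding or subtracting [e] times that coordinate keeps
   [a] nonnegative on the cones. Both perturbed functionals are monotone along the path, which
   bounds the coordinate by the increase of [a]. *)
have mono (k : R) i : k = 1 \/ k = -1 ->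
    (c x *m a) 0 0 + k * e * c x 0 i <= (c (H (s, q)) *m a) 0 0 + k * e * c (H (s, q)) 0 i /\
    (c (H (s, q)) *m a) 0 0 + k * e * c (H (s, q)) 0 i <= (c y *m a) 0 0 + k * e * c y 0 i.
  move=> k1; pose b := a + (k * e) *: delta_mx i 0.
  have bE u : (u *m b) 0 0 = (u *m a) 0 0 + k * e * u 0 i.
    by rewrite /b mulmxDr -scalemxAr !mxE -[in RHS]pair_delta mxE.
  have b0 z : O z -> forall v, future_causal c z v -> 0 <= (v *m b) 0 0.
    move=> /OP[_ aO] v /aO; rewrite bE; have := coord_le_norm v i.
    have := ler_norm (v 0 i); have := ler_norm (- v 0 i); rewrite normrN.
    case: k1 => ->; nra.
  have M := causal_path_pairing Ac oO (@subIsetl _ _ _) b0 (HP s sI) Os.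
  move: qI; rewrite in_itv /= => /andP[q0 q1].
  have := M 0 q (lexx _) q0 q1; have := M q 1 q0 q1 (lexx _).
  by rewrite Hs0 Hs1 !bE.
have : `|c x - c (H (s, q))| <= r / 4.
  apply: norm_le_coord => [|i]; first lra.
  rewrite !mxE ler_norml.
  have [M1 M2] := mono 1 i (or_introl erefl).
  have [M3 M4] := mono (-1) i (or_intror erefl).
  move: x2 yy2; rewrite !ltr_norml => /andP[z1 z2] /andP[z3 z4].
  apply/andP; split; rewrite -(ler_pM2l e0); nra.
have -> : B (c (H (s, q))) = (`|(c p - c x) + (c x - c (H (s, q)))| <= r / 2).
  by rewrite /B /= addrA subrK.
by move=> h; apply: le_trans (ler_normD _ _) _; lra.
Qed.

End local_causality.

(** * Conformality *)

Section jacobians.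
Context {R : realType}.

Lemma jacobian_eqP n m (f : 'rV[R]_n.+1 -> 'rV[R]_m.+1) u (J : 'M[R]_(n.+1, m.+1)) :
  (forall v, 'd f u v = v *m J) -> jacobian f u = J.
Proof.
by move=> fJ; apply/row_matrixP => i; rewrite !rowE /jacobian mul_rV_lin1 -fJ.
Qed.

Lemma smooth_map_id n (X : smooth_manifold R n) : smooth_map (@id X).
Proof. by split=> [x|c d Ac Ad]; [exact: cvg_id|exact: atlas_smooth]. Qed.

Lemma smooth_map_differentiable n m (X : smooth_manifold R n) (Y : smooth_manifold R m)
    (f : X -> Y) (c : chart R n X) (d : chart R m Y) x :
  smooth_map f -> atlas c -> atlas d -> chart_dom c x -> chart_dom d (f x) ->
  differentiable (local_expr c d f) (c x).
Proof.
move=> [_ sf] Ac Ad cx dfx; have [df _] : Ck_on 1 (local_dom c d f) (local_expr c d f) by exact: sf.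
by apply: df; split; [exact: chart_fun_cod|rewrite chart_funK].
Qed.

Lemma local_jacobian_id n (X : smooth_manifold R n) (c : chart R n X) x :
  chart_dom c x -> local_jacobian c c id x = 1%:M.
Proof.
move=> cx; apply: jacobian_eqP => v; rewrite mulmx1.
have id_near : \forall u \near c x, id u = local_expr c c id u.
  by apply: filterS (chart_cod_nbhs (chart_fun_cod cx)) => u cu; rewrite /local_expr /= chart_invK.
have [_ ->] := near_eq_diff id_near (@ex_diff _ _ _ _ _ _ _ _).
by rewrite diff_val.
Qed.

Lemma local_jacobian_comp n m q (X : smooth_manifold R n) (Y : smooth_manifold R m)
    (Z : smooth_manifold R q) (f : X -> Y) (g : Y -> Z)
    (c : chart R n X) (d : chart R m Y) (e : chart R q Z) x :
  smooth_map f -> smooth_map g -> atlas c -> atlas d -> atlas e ->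
  chart_dom c x -> chart_dom d (f x) -> chart_dom e (g (f x)) ->
  local_jacobian c e (g \o f) x = local_jacobian c d f x *m local_jacobian d e g (f x).
Proof.
move=> sf sg Ac Ad Ae cx dfx egx; apply: jacobian_eqP => v.
have Df := smooth_map_differentiable sf Ac Ad cx dfx.
have fE : local_expr c d f (c x) = d (f x) by rewrite /local_expr /= chart_funK.
have Dg : differentiable (local_expr d e g) (local_expr c d f (c x)).
  by rewrite fE; exact: smooth_map_differentiable.
have near_comp : \forall u \near c x,
    (local_expr d e g \o local_expr c d f) u = local_expr c e (g \o f) u.
  have : f (chart_inv c u) @[u --> c x] --> f x.
    rewrite -[in X in _ --> X](chart_funK cx).
    exact: (cvg_comp _ _ (chart_inv_cvg (chart_fun_cod cx)) (sf.1 _)).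
  move=> fc; have : \forall u \near c x, chart_dom d (f (chart_inv c u)).
    exact: fc (chart_dom_nbhs dfx).
  apply: filterS => u /= du.
  by rewrite /local_expr /= chart_funK.
have [_ ->] := near_eq_diff near_comp (differentiable_comp Df Dg).
rewrite diff_comp//= -!deriveE// !deriveEjacobian// mulmxA.
by rewrite fE.
Qed.

(** [y] is kept separate from [f x] so that the lemma also applies to the inverse map, where
    [G (F x) = x] is only propositional. *)
Lemma local_jacobian_inverse n m (X : smooth_manifold R n) (Y : smooth_manifold R m)
    (f : X -> Y) (g : Y -> X) (c : chart R n X) (d : chart R m Y) x y :
  smooth_map f -> smooth_map g -> cancel f g -> f x = y -> atlas c -> atlas d ->
  chart_dom c x -> chart_dom d y ->
  local_jacobian c d f x *m local_jacobian d c g y = 1%:M.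
Proof.
move=> sf sg fg <- Ac Ad cx dfx.
rewrite -(local_jacobian_comp sf sg Ac Ad Ac cx dfx); last by rewrite fg.
by rewrite (_ : g \o f = id) ?local_jacobian_id//; apply/funext.
Qed.

End jacobians.

Section path_inclusions.
Context {R : realType} {X : topologicalType} (L L' : local_order X).
Hypothesis LL' : forall U x y, L U x y -> L' U x y.

Lemma is_path_sub x y (g : R -> X) : is_path L x y g -> is_path L' x y g.
Proof.
move=> [cg og g0 g1]; split=> // t0 t0I U oU Ut0.
have [d d0 dP] := og t0 t0I U oU Ut0.
by exists d => // s t sd sI td tI st; apply: LL'; exact: dP.
Qed.

Lemma path_homotopy_sub x y (g g' : R -> X) :
  path_homotopy L x y g g' -> path_homotopy L' x y g g'.
Proof.
move=> [H [cH H0 H1 HP]]; exists H; split=> // s sI.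
by apply: is_path_sub; exact: HP.
Qed.

End path_inclusions.

Section cone_preservation.
Context {R : realType} {n m : nat} {X : spacetime R n} {Y : spacetime R m}.
Variables (LX : local_order X) (LY : local_order Y).
Hypothesis chron_LX : forall U x y, chron_before U x y -> LX U x y.
Hypothesis LX_causal : forall U x y, LX U x y -> causally_before U x y.
Hypothesis LY_causal : forall U x y, LY U x y -> causally_before U x y.
Variable F : semifunctor (@path_semicategory R X LX) (@path_semicategory R Y LY).
Variable G : semifunctor (@path_semicategory R Y LY) (@path_semicategory R X LX).
Hypothesis GF : semifunctor_comp G F = semifunctor_id _.
Hypothesis FG : semifunctor_comp F G = semifunctor_id _.
Hypothesis smF : smooth_map (fobj F : X -> Y).

Lemma iso_timelike_causal (c : chart R n X) (d : chart R m Y) (p : X) v :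
  atlas c -> atlas d -> chart_dom c p -> chart_dom d (F p) ->
  future_timelike c p v ->
  bilinear_form (metric d (F p)) (v *m local_jacobian c d (fobj F : X -> Y) p)
    (v *m local_jacobian c d (fobj F : X -> Y) p) <= 0.
Proof.
move=> Ac Ad cp dFp vp.
have FGE z : F (G z) = z by exact: (congr1 (fun K : semifunctor _ _ => K z) FG).
pose f0 := local_expr c d (fobj F : X -> Y).
(* By duality it suffices that, for every future timelike [w], the functional [a] is nonnegative on
   the image of [v]. *)
apply: (causal_of_future_dual (metric_lorentzian Ad dFp) (time_field_timelike Ad dFp)).
move=> w ww wT; pose a := - (metric d (F p) *m w^T).
have aE u : (u *m a) 0 0 = - bilinear_form (metric d (F p)) w u.
  by rewrite (bilinear_formC _ _ (metric_symmetric Ad dFp)) mulmxN mulmxA mxE.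
rewrite -oppr_ge0 -aE -deriveEjacobian; last exact: smooth_map_differentiable.
have [e e0 ae] := causal_pairing_ge (a := a) Ad dFp
  (fun u => time_field_pairing Ad dFp (conj ww wT)).
pose V : set Y := (chart_dom d `&` [set y | forall u, future_causal d y u ->
    e * `|u| <= (u *m a) 0 0])°.
have oV : open V by exact: open_interior.
have VP y : V y -> chart_dom d y /\ forall u, future_causal d y u -> 0 <= (u *m a) 0 0.
  move=> /interior_subset[dy uP]; split=> // u /uP; apply: le_trans.
  by rewrite mulr_ge0// ltW.
have VFp : nbhs p ((fobj F : X -> Y) @^-1` V).
  apply: (smF.1 p); apply: open_nbhs_nbhs; split=> //.
  by apply: filterI => //; exact: chart_dom_nbhs.
have [U pU Uconf] := small_path_homotopy_confined VFp.
have [r r0 rP] := straight_path Ac cp vp pU.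
(* The straight segment is an [LX]-path whose homotopies are causal, hence confined to the preimage
   of [V]. So [iso_path] provides a path in [V] joining the images of its end points, and [a] is
   nondecreasing along it. *)
have f0_le h : 0 < h < r -> (f0 (c p) *m a) 0 0 <= (f0 (c p + h *: v) *m a) 0 0.
  move=> /rP[pg Ug]; have [g pg' Vg] := iso_path GF (is_path_sub (L := chronological_order X) chron_LX pg)
    (fun g' gg' => Uconf _ _ _ _ Ug (path_homotopy_sub (L' := causal_order X) LX_causal gg')).
  have pg'' := is_path_sub (L' := causal_order Y) LY_causal pg'.
  have Vg' t : t \in `[0, 1] -> V (g t).
    by move=> /Vg /=; rewrite FGE.
  have := causal_path_pairing Ad oV (fun y Vy => (VP y Vy).1) (fun y Vy => (VP y Vy).2)
    pg'' Vg' (lexx 0) ler01 (lexx 1).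
  have [_ _ -> ->] := pg''.
  by rewrite /f0 /local_expr /= chart_funK.
rewrite leNgt; apply/negP => Da.
have df0 : h^-1 *: (f0 (h *: v + c p) - f0 (c p)) @[h --> (0 : R)^'] --> 'D_v f0 (c p).
  apply: (@diff_derivable _ _ _ f0 (c p) v); exact: smooth_map_differentiable.
have : \forall h \near (0 : R), h != 0 ->
    ((h^-1 *: (f0 (h *: v + c p) - f0 (c p))) *m a) 0 0 < 0.
  exact: cvgr_lt _ (cvg_pairing (a := a) _ df0) _ Da.
move=> /nbhs_ballP[s /= s0 sP].
pose h := Num.min (r / 2) (s / 2).
have h0 : 0 < h by rewrite lt_min !divr_gt0.
have hr : h <= r / 2 by rewrite ge_min lexx.
have hs : h <= s / 2 by rewrite ge_min lexx orbT.
have := sP h; rewrite /ball /= sub0r normrN gtr0_norm// => /(_ _ (lt0r_neq0 h0)).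
have -> : ((h^-1 *: (f0 (h *: v + c p) - f0 (c p))) *m a) 0 0 =
    h^-1 * ((f0 (c p + h *: v) *m a) 0 0 - (f0 (c p) *m a) 0 0).
  by rewrite -scalemxAl mulmxBl !mxE (addrC (h *: v)).
have hf : 0 < h < r by rewrite h0 /=; lra.
have := f0_le h hf; rewrite -subr_ge0 => f0h.
have hs' : h < s by lra.
by move=> /(_ hs'); rewrite ltNge mulr_ge0// invr_ge0 ltW.
Qed.

End cone_preservation.

Section conformal_factor.
Context {R : realType} {n m : nat} {X : spacetime R n} {Y : spacetime R m}.
Implicit Types (c : chart R n X) (d : chart R m Y).

Definition pullback_metric (f : X -> Y) c d x : 'M[R]_n.+1 :=
  local_jacobian c d f x *m metric d (f x) *m (local_jacobian c d f x)^T.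

Lemma pullback_metric_sym (f : X -> Y) c d x : atlas d -> chart_dom d (f x) ->
  (pullback_metric f c d x)^T = pullback_metric f c d x.
Proof.
by move=> Ad dfx; rewrite /pullback_metric !trmx_mul trmxK metric_symmetric// mulmxA.
Qed.

Lemma pullback_metric_change (f : X -> Y) c c' d d' x : smooth_map f ->
  atlas c -> atlas c' -> atlas d -> atlas d' ->
  chart_dom c x -> chart_dom c' x -> chart_dom d (f x) -> chart_dom d' (f x) ->
  pullback_metric f c d x = local_jacobian c c' id x *m pullback_metric f c' d' x
    *m (local_jacobian c c' id x)^T.
Proof.
move=> sf Ac Ac' Ad Ad' cx cx' dx dx'.
have JE : local_jacobian c d' f x = local_jacobian c d f x *m local_jacobian d d' id (f x).
  exact: (local_jacobian_comp sf (smooth_map_id Y) Ac Ad Ad').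
have JE' : local_jacobian c d' f x = local_jacobian c c' id x *m local_jacobian c' d' f x.
  exact: (local_jacobian_comp (smooth_map_id X) sf Ac Ac' Ad').
rewrite /pullback_metric (metric_change Ad Ad' dx dx').
transitivity (local_jacobian c d' f x *m metric d' (f x) *m (local_jacobian c d' f x)^T).
  by rewrite JE trmx_mul !mulmxA.
by rewrite JE' trmx_mul !mulmxA.
Qed.

(** Locally [w] is the quotient of the two forms at a single vector field. The time field is only
    continuous, so its value at [x] is extended with constant components in the chart; it stays
    timelike nearby, and the denominator does not vanish. *)
Lemma conformal_factor_smooth (f : X -> Y) (w : X -> R) : smooth_map f ->
  (forall c d x, atlas c -> atlas d -> chart_dom c x -> chart_dom d (f x) ->
     pullback_metric f c d x = w x *: metric c x) ->
  smooth_function w.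
Proof.
move=> sf wP c Ac k; apply: Ck_on_local => u cu.
have cx := chart_inv_dom cu; set x := chart_inv c u in cx.
have [d Ad dfx] := atlas_cover (f x).
pose e := time_field c x.
pose den u' := bilinear_form (metric c (chart_inv c u')) e e.
pose De := 'D_e (local_expr c d f).
pose num u' := bilinear_form (metric d (f (chart_inv c u'))) (De u') (De u').
pose U' := [set u' | local_dom c d f u' /\ den u' < 0]°.
have oU' : open U' by exact: open_interior.
have U'P u' : U' u' -> local_dom c d f u' /\ den u' < 0 by move=> /interior_subset.
have sf1 j : Ck_on j U' (local_expr c d f).
  by apply: Ck_on_subset (sf.2 c d Ac Ad j) => u' /U'P[].
exists U'.
  have fc : f (chart_inv c u') @[u' --> u] --> f x.
    exact: (cvg_comp _ _ (chart_inv_cvg cu) (sf.1 x)).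
  have n1 : \forall u' \near u, chart_dom d (f (chart_inv c u')) by exact: fc (chart_dom_nbhs dfx).
  have n2 : \forall u' \near u, den u' < 0.
    have dc : den u' @[u' --> u] --> bilinear_form (metric c x) e e.
      apply: (@cvg_bilinear_form R _ (nbhs u)); try exact: cvg_cst.
      exact: (cvg_comp _ _ (chart_inv_cvg cu) (metric_cvg Ac cx)).
    exact: (cvgr_lt _ dc _ (time_field_timelike Ac cx)).
  by apply: filterS3 (chart_cod_nbhs cu) n1 n2 => u' ? ? ?; split.
have Cden : Ck_on k U' (den : _ -> R^o).
  apply: Ck_on_bilinear_form => //; try exact: Ck_on_cst.
  move=> i j; apply: Ck_on_coord => //.
  by apply: Ck_on_subset (metric_smooth Ac k) => u' /U'P[[]].
have Cnum : Ck_on k U' (num : _ -> R^o).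
  apply: Ck_on_bilinear_form => //; try exact: (sf1 k.+1).2.
  move=> i j.
  pose h v := (metric d (chart_inv d v)) i j : R^o.
  apply: (@Ck_on_eq _ _ _ _ _ (h \o local_expr c d f)) => //.
    by move=> u' /U'P[[_ du'] _]; rewrite /h /local_expr /= chart_funK.
  apply: (@Ck_on_comp _ _ _ _ _ (chart_cod d)) => //.
    by move=> u' /U'P[[_ du'] _]; exact: chart_fun_cod.
  apply: Ck_on_coord; first exact: chart_cod_open.
  exact: metric_smooth.
apply: (@Ck_on_eq _ _ _ _ _ (fun u' => num u' * (den u')^-1 : R^o)) => //.
  move=> u' /U'P[[cu' du'] den0] /=.
  have dl : differentiable (local_expr c d f) u'.
    exact: (sf.2 c d Ac Ad 1).1.
  have -> : num u' = w (chart_inv c u') * den u'.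
    rewrite /num /De deriveEjacobian//.
    have -> : jacobian (local_expr c d f) u' = local_jacobian c d f (chart_inv c u').
      by rewrite /local_jacobian chart_invK.
    rewrite -bilinear_form_congr.
    rewrite -[X in bilinear_form X _ _]/(pullback_metric f c d (chart_inv c u')).
    rewrite wP//; last exact: chart_inv_dom.
    by rewrite /den /bilinear_form -scalemxAr -scalemxAl [LHS]mxE.
  by rewrite mulfK// lt_eqF.
apply: Ck_on_mul => //; apply: Ck_on_inv => // u' /U'P[_ /lt_eqF ->] //.
Qed.

End conformal_factor.

Section isomorphism.
Context {R : realType}.

Lemma iso_timelike_pullback n m (X : spacetime R n) (Y : spacetime R m)
    (LX : local_order X) (LY : local_order Y)
    (F : semifunctor (@path_semicategory R X LX) (@path_semicategory R Y LY))
    (G : semifunctor (@path_semicategory R Y LY) (@path_semicategory R X LX))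
    (c : chart R n X) (d : chart R m Y) (p : X) v :
  (forall U x y, chron_before U x y -> LX U x y) ->
  (forall U x y, LX U x y -> causally_before U x y) ->
  (forall U x y, LY U x y -> causally_before U x y) ->
  semifunctor_comp G F = semifunctor_id _ -> semifunctor_comp F G = semifunctor_id _ ->
  smooth_map (fobj F : X -> Y) ->
  atlas c -> atlas d -> chart_dom c p -> chart_dom d (F p) ->
  bilinear_form (metric c p) v v < 0 ->
  bilinear_form (pullback_metric (fobj F : X -> Y) c d p) v v <= 0.
Proof.
move=> cLX LXc LYc GF FG sF Ac Ad cp dp vv.
have P u := @iso_timelike_causal R n m X Y LX LY cLX LXc LYc F G GF FG sF c d p u Ac Ad cp dp.
rewrite /pullback_metric bilinear_form_congr.
have [/P//|/P] := timelike_future Ac cp vv.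
by rewrite -scaleN1r -scalemxAl !bilinear_formE mulN1r mulN1r opprK.
Qed.

Lemma iso_conformal n m (X : spacetime R n) (Y : spacetime R m)
    (LX : local_order X) (LY : local_order Y)
    (F : semifunctor (@path_semicategory R X LX) (@path_semicategory R Y LY)) :
  (forall U x y, chron_before U x y -> LX U x y) ->
  (forall U x y, chron_before U x y -> LY U x y) ->
  (forall U x y, LX U x y -> causally_before U x y) ->
  (forall U x y, LY U x y -> causally_before U x y) ->
  semicategory_iso F -> diffeomorphism (fobj F : X -> Y) ->
  conformal_diffeomorphism (fobj F : X -> Y).
Proof.
move=> cLX cLY LXc LYc [G [GF FG]] diffF; split=> //.
case: diffF => sF [f' [Ff' f'F sf']].
have GFE z : G (F z) = z by exact: (congr1 (fun K : semifunctor _ _ => K z) GF).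
have f'G : f' = (fobj G : Y -> X) by apply/funext => y; rewrite -[LHS]GFE f'F.
rewrite {}f'G in Ff' f'F sf'.
have /choice[w wP] : forall x : X, exists w : R, 0 < w /\
    forall (c : chart R n X) (d : chart R m Y), atlas c -> atlas d ->
      chart_dom c x -> chart_dom d (F x) ->
      pullback_metric (fobj F : X -> Y) c d x = w *: metric c x.
  move=> x; have [c Ac cx] := atlas_cover x.
  have [d Ad dx] := atlas_cover (F x : Y).
  have Gsym := metric_symmetric Ac cx.
  have Hsym := pullback_metric_sym c Ad dx.
  have GFx : G (F x) = x by exact: Ff'.
  have cGFx : chart_dom c (G (F x)) by rewrite GFx.
  have JK := local_jacobian_inverse sF sf' Ff' (erefl (F x : Y)) Ac Ad cx dx.
  have KJ := local_jacobian_inverse sf' sF f'F GFx Ad Ac dx cx.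
  have GH v := @iso_timelike_pullback _ _ _ _ LX LY F G c d x v cLX LXc LYc GF FG sF Ac Ad cx dx.
  (* This is the statement for the inverse [G], applied to the image of [v] under the differential
     of [F]; [JK] cancels the two Jacobians. *)
  have HG v : bilinear_form (pullback_metric (fobj F : X -> Y) c d x) v v < 0 ->
      bilinear_form (metric c x) v v <= 0.
    rewrite /pullback_metric bilinear_form_congr => uu.
    have := iso_timelike_pullback cLY LYc LXc FG GF sf' Ad Ac dx cGFx uu.
    by rewrite /pullback_metric bilinear_form_congr GFx -!mulmxA JK !mulmx1.
  have [w w0 wE] := conformal_of_inclusions Gsym Hsym GH HG (metric_lorentzian Ac cx).
  exists w; split; last first.
    move=> c' d' Ac' Ad' cx' dx'.
    rewrite (pullback_metric_change sF Ac' Ac Ad' Ad cx' cx dx' dx) wE.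
    by rewrite (metric_change Ac' Ac cx' cx) -scalemxAr -scalemxAl.
  (* With a zero factor the pullback vanishes, and by [KJ] so does the metric of [Y] at [F x], which
     has a timelike vector. *)
  rewrite lt_neqAle w0 andbT eq_sym; apply/eqP => w00.
  have H0 : metric d (F x) = 0.
    rewrite -[LHS]mulmx1 -[X in X *m _]mul1mx -{1}KJ -[1%:M]trmx1 -KJ trmx_mul.
    rewrite -!mulmxA (mulmxA _ _ (_^T *m _)).
    by rewrite [X in _ *m X]mulmxA -/(pullback_metric (fobj F : X -> Y) c d x) wE w00 scale0r mul0mx mulmx0.
  have := time_field_timelike Ad dx.
  by rewrite H0 /bilinear_form mulmx0 mul0mx mxE ltxx.
exists w; split=> [x||c d x Ac Ad cx dx]; first by have [] := wP x.
- apply: (conformal_factor_smooth sF) => c d x; exact: (wP x).2.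
- exact: (wP x).2.
Qed.

End isomorphism.

Theorem corollary3 (R : realType) (n m : nat)
    (X : spacetime R n) (Y : spacetime R m) :
  (forall F : functor (Pi_c X) (Pi_c Y),
     category_iso F ->
     diffeomorphism (F : X -> Y) ->
     conformal_diffeomorphism (F : X -> Y)) /\
  (forall F : semifunctor (Pi_t X) (Pi_t Y),
     semicategory_iso F ->
     diffeomorphism (F : X -> Y) ->
     conformal_diffeomorphism (F : X -> Y)).
Proof.
split=> F.
  move=> [G [GF FG]]; apply: iso_conformal => //.
  - exact: curve_joins_causal.
  - exact: curve_joins_causal.
  exists G; split; first exact: (congr1 (fun K => functor_semi K) GF).
  exact: (congr1 (fun K => functor_semi K) FG).
move=> isoF; apply: iso_conformal => //; exact: curve_joins_causal.
Qed.
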